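(* Let $G$ be a chordal graph on $[n]$ and let $\Delta(G)$ be a graph returned by the algorithm described in the context. Then $\Delta(G) = \Delta^e(G)$, and there is a combinatorial shifted graph $\Delta^c(G)$ of $G$ with $\Delta(G) = \Delta^c(G)$.
   Context: Graphs are finite with no loops or multiple edges; $G$ is chordal if every cycle of length $>3$ has a chord. A graph on $[n]$ is shifted if for every edge $\{i,j\}$ and all $i'\le i$, $j'\le j$ with $i'\neq j'$, $\{i',j'\}$ is an edge. For $1\le i<j\le n$ and a graph $H$, $\mathrm{Shift}_{ij}(H)$ is the graph on the same vertices whose edges are $C_{ij}(S)$ for $S\in E(H)$, where $C_{ij}(S)=(S\setminus\{j\})\cup\{i\}$ if $j\in S$, $i\notin S$ and $(S\setminus\{j\})\cup\{i\}\notin E(H)$, and $C_{ij}(S)=S$ otherwise. A combinatorial shifted graph of $G$ is any shifted graph of the form $\mathrm{Shift}_{i_qj_q}(\cdots\mathrm{Shift}_{i_1j_1}(G)\cdots)$ with $1\le i_t<j_t\le n$. $\mathrm{Shift}_{ij}$ is an edge shift of $H$ if $\{i,j\}\in E(H)$, and a disjoint shift of $H$ if there is no path from $i$ to $j$ in $H$. A vertex $v$ is isolated if $\deg_H(v)=0$, and is a star vertex of $H$ if $\{u,v\}\in E(H)$ for every vertex $u\ne v$ with $\deg_H(u)>0$. Algorithm: set $\Delta:=\emptyset$, $V:=[n]$, $H:=(V,E(G))$; repeat (I),(II),(III) until $H$ has no edges. (I) Let $u:=\min V$. If $H$ has at least two connected components that are not isolated vertices, repeat disjoint shifts $H:=\mathrm{Shift}_{uj}(H)$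 for some $j\in V$ with $\deg_H(j)\neq0$ until $H$ has exactly one connected component that is not an isolated vertex. (II) If $H$ has one such component and $u$ is not a star vertex, repeat edge shifts $H:=\mathrm{Shift}_{uv}(H)$ for $v\in V$ with $\{u,v\}\in E(H)$ until $u$ is a star vertex of $H$. (III) If $H$ has one such component and $u$ is a star vertex, set $\Delta:=\Delta\cup\{\{u,u+1\},\dots,\{u,u+\deg_H(u)\}\}$, $V:=V\setminus\{u\}$, and replace $H$ by its induced subgraph on $V$. Return $\Delta(G)=([n],\Delta)$. Exterior algebraic shifting: let $K$ be a field of characteristic $0$, $E$ the exterior algebra over $K$ on basis $e_1,\dots,e_n$, with $g=(a_{ij})\in GL_n(K)$ acting by $e_j\mapsto\sum_i a_{ij}e_i$; for a graded ideal $J\subset E$, $\mathrm{Gin}(J)$ is the initial ideal of $g(J)$, constant for $g$ in a nonempty Zariski open set, with respect to the degree reverse lexicographic order induced by $e_1\prec\cdots\prec e_n$. $J_G$ is generated by $e_i\wedge e_j$ with $\{i,j\}\notin E(G)$ and all monomials of degree $3$; $\Delta^e(G)$ is the graph on $[n]$ with edges $\{i,j\}$ such that $e_i\wedge e_j\notin\mathrm{Gin}(J_G)$. *)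

(* Defs.v *)
From HB Require Import structures.
From mathcomp Require Import all_boot all_order all_algebra.
From mathcomp Require Import mpoly.
Set Implicit Arguments.
Unset Strict Implicit.
Unset Printing Implicit Defensive.
Import GRing.Theory.
Local Open Scope ring_scope.

(* The vertex set {1, ..., n} is represented by 'I_n = {0, ..., n - 1}, and a
   graph on it by its edge set, a set of two-element sets of vertices. *)

Section Graphs.
Variable n : nat.
Implicit Types (E H G D : {set {set 'I_n}}) (V S : {set 'I_n}) (i j u v : 'I_n).

Definition simple_graph E : bool := [forall S in E, #|S| == 2].

Definition adj E : rel 'I_n := fun x y => [set x; y] \in E.

Definition deg E v : nat := #|[set x | adj E v x]|.

(* A cycle is a closed walk without repeated vertices; a chord joins two of its
   vertices that are not consecutive. *)
Definition chordal E : Prop :=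
  forall c : seq 'I_n, ucycle (adj E) c -> (3 < size c)%N ->
  exists x y, [/\ x \in c, y \in c, adj E x y, y != next c x & x != next c y].

Definition shifted E : Prop :=
  forall i j i' j', [set i; j] \in E ->
  (i' <= i)%N -> (j' <= j)%N -> i' != j' -> [set i'; j'] \in E.

Definition shift_face i j E S : {set 'I_n} :=
  if [&& j \in S, i \notin S & (i |: (S :\ j)) \notin E] then i |: (S :\ j)
  else S.

Definition shift i j E : {set {set 'I_n}} := [set shift_face i j E S | S in E].

Definition combinatorial_shifted G D : Prop :=
  shifted D /\
  exists2 s : seq ('I_n * 'I_n), all (fun p : 'I_n * 'I_n => p.1 < p.2)%N s &
    D = foldl (fun H p => shift p.1 p.2 H) G s.

Definition edge_shift H i j : bool := adj H i j.

Definition disjoint_shift H i j : bool := ~~ connect (adj H) i j.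

Definition star_vertex H v : bool :=
  [forall u, (u != v) ==> (0 < deg H u)%N ==> adj H u v].

(* The number of connected components that are not isolated vertices. *)
Definition nb_comp H : nat :=
  #|[set [set y | connect (adj H) x y] | x in [set x | (0 < deg H x)%N]]|.

End Graphs.

(* "Repeat [step] until [stop]": the body is executed at least once, and the
   stopping condition is tested after each execution. *)
Inductive repeat_until (T : Type) (step : T -> T -> Prop) (stop : pred T) :
    T -> T -> Prop :=
| RepeatStop x y : step x y -> stop y -> repeat_until step stop x y
| RepeatNext x y z : step x y -> ~~ stop y ->
    repeat_until step stop y z -> repeat_until step stop x z.

Section Algorithm.
Variable n : nat.
Implicit Types (H : {set {set 'I_n}}) (V : {set 'I_n}) (u : 'I_n).

(* The variables of the algorithm. The graph [st_H] on the vertex set [st_V] is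
   stored as an edge set on 'I_n; the vertices outside [st_V] have degree 0. *)
Record state := State {
  st_D : {set {set 'I_n}};
  st_V : {set 'I_n};
  st_H : {set {set 'I_n}} }.

Definition is_min V u : Prop := u \in V /\ forall v, v \in V -> (u <= v)%N.

Definition stepI V u H H' : Prop :=
  exists j, [/\ j \in V, deg H j != 0%N, disjoint_shift H u j & H' = shift u j H].

Definition phaseI V u H H' : Prop :=
  if (1 < nb_comp H)%N
  then repeat_until (stepI V u) (fun H1 => nb_comp H1 == 1%N) H H'
  else H' = H.

Definition stepII V u H H' : Prop :=
  exists v, [/\ v \in V, edge_shift H u v & H' = shift u v H].

Definition phaseII V u H H' : Prop :=
  if (nb_comp H == 1%N) && ~~ star_vertex H u
  then repeat_until (stepII V u) (fun H1 => star_vertex H1 u) H H'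
  else H' = H.

Definition phaseIII u (s : state) : state :=
  let: State D V H := s in
  if (nb_comp H == 1%N) && star_vertex H u
  then State (D :|: [set [set u; v] | v : 'I_n & (u < v <= u + deg H u)%N])
             (V :\ u)
             [set S in H | S \subset V :\ u]
  else s.

Definition alg_round (s s' : state) : Prop :=
  exists u H1 H2,
    [/\ is_min (st_V s) u, phaseI (st_V s) u (st_H s) H1,
        phaseII (st_V s) u H1 H2
      & s' = phaseIII u (State (st_D s) (st_V s) H2)].

(* [D] is the edge set of a graph that some execution of the algorithm on the
   input [G] returns. *)
Definition alg_returns (G D : {set {set 'I_n}}) : Prop :=
  exists2 s : state,
    repeat_until alg_round (fun s' => st_H s' == set0)
      (State set0 [set: 'I_n] G) s
    & D = st_D s.

End Algorithm.

(* The exterior algebra on e_0, ..., e_(n-1): the function f stands for the sum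
   of the f S *: e_S, where e_S is the product, in increasing order, of the e_i
   for i in S. *)
Definition exterior (K : fieldType) (n : nat) : Type := {ffun {set 'I_n} -> K}.

HB.instance Definition _ (K : fieldType) (n : nat) :=
  Vector.copy (exterior K n) {ffun {set 'I_n} -> K^o}.

Section Exterior.
Variables (K : fieldType) (n : nat).
Notation E := (exterior K n).
Implicit Types (S T U : {set 'I_n}) (f g h : E).

Definition ext_mono S : E := [ffun T => (T == S)%:R].

Definition inversions S T : nat :=
  #|[set p in setX S T | (p.2 < p.1)%N]|.

Definition ext_sign S T : K :=
  if [disjoint S & T] then (-1) ^+ inversions S T else 0.

Definition ext_mul f g : E :=
  \sum_S \sum_T (f S * g T * ext_sign S T) *: ext_mono (S :|: T).

Lemma ext_monoE f : f = \sum_S f S *: ext_mono S.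
Proof.
apply/ffunP=> U; rewrite sum_ffunE (bigD1 U) //= !ffunE eqxx.
rewrite big1 ?addr0 => [|S neSU]; first by rewrite /GRing.scale /= mulr1.
by rewrite !ffunE eq_sym (negbTE neSU) scaler0.
Qed.

Lemma ext_mulDl : left_distributive ext_mul +%R.
Proof.
move=> f g h; rewrite /ext_mul -big_split; apply: eq_bigr => S _ /=.
rewrite -big_split; apply: eq_bigr => T _ /=.
by rewrite ffunE -scalerDl !mulrDl.
Qed.

Lemma ext_mulDr : right_distributive ext_mul +%R.
Proof.
move=> f g h; rewrite /ext_mul -big_split; apply: eq_bigr => S _ /=.
rewrite -big_split; apply: eq_bigr => T _ /=.
by rewrite ffunE -scalerDl mulrDr mulrDl.
Qed.

Lemma ext_mulZl (a : K) f g : ext_mul (a *: f) g = a *: ext_mul f g.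
Proof.
rewrite /ext_mul scaler_sumr; apply: eq_bigr => S _.
rewrite scaler_sumr; apply: eq_bigr => T _.
by rewrite ffunE scalerA -!mulrA.
Qed.

Lemma ext_mulZr (a : K) f g : ext_mul f (a *: g) = a *: ext_mul f g.
Proof.
rewrite /ext_mul scaler_sumr; apply: eq_bigr => S _.
rewrite scaler_sumr; apply: eq_bigr => T _.
by rewrite ffunE scalerA /GRing.scale /= mulrCA -!mulrA.
Qed.

Lemma ext_mul_mono S T :
  ext_mul (ext_mono S) (ext_mono T) = ext_sign S T *: ext_mono (S :|: T).
Proof.
rewrite /ext_mul (bigD1 S) //= (bigD1 T) //= !ffunE !eqxx !mul1r.
rewrite !big1 ?addr0 // => [A neA | A neA].
  by rewrite big1 // => B _; rewrite ffunE (negbTE neA) !mul0r scale0r.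
by rewrite [ext_mono T A]ffunE (negbTE neA) mulr0 mul0r scale0r.
Qed.

Lemma ext_mul_suml (I : finType) (F : I -> E) g :
  ext_mul (\sum_i F i) g = \sum_i ext_mul (F i) g.
Proof.
have mul0 : ext_mul 0 g = 0 by have:= ext_mulZl 0 0 g; rewrite !scale0r.
exact: (big_morph (ext_mul^~ g) (fun f h => ext_mulDl f h g) mul0).
Qed.

Lemma ext_mul_sumr (I : finType) (F : I -> E) g :
  ext_mul g (\sum_i F i) = \sum_i ext_mul g (F i).
Proof.
have mul0 : ext_mul g 0 = 0 by have:= ext_mulZr 0 g 0; rewrite !scale0r.
exact: (big_morph (ext_mul g) (ext_mulDr g) mul0).
Qed.

Lemma ext_mulEl f g : ext_mul f g = \sum_S f S *: ext_mul (ext_mono S) g.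
Proof.
rewrite {1}(ext_monoE f) ext_mul_suml.
by apply: eq_bigr => S _; rewrite ext_mulZl.
Qed.

Lemma ext_mulEr f g : ext_mul f g = \sum_S g S *: ext_mul f (ext_mono S).
Proof.
rewrite {1}(ext_monoE g) ext_mul_sumr.
by apply: eq_bigr => S _; rewrite ext_mulZr.
Qed.

Lemma inversionsUl S T U :
  [disjoint S & T] ->
  inversions (S :|: T) U = (inversions S U + inversions T U)%N.
Proof.
move=> dST; rewrite /inversions -cardsUI [X in (_ + X)%N]eq_card0 ?addn0.
  apply: eq_card => -[i j]; rewrite !inE /=.
  by case: (i \in S); case: (i \in T); case: (j \in U); case: (j < i)%N.
move=> [i j]; rewrite !inE /=; apply/negP=> /andP[/andP[/andP[iS _] _]].
by case/andP=> /andP[iT _] _; rewrite (disjointFr dST iS) in iT.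
Qed.

Lemma inversionsUr S T U :
  [disjoint T & U] ->
  inversions S (T :|: U) = (inversions S T + inversions S U)%N.
Proof.
move=> dTU; rewrite /inversions -cardsUI [X in (_ + X)%N]eq_card0 ?addn0.
  apply: eq_card => -[i j]; rewrite !inE /=.
  by case: (i \in S); case: (j \in T); case: (j \in U); case: (j < i)%N.
move=> [i j]; rewrite !inE /=; apply/negP=> /andP[/andP[/andP[_ jT] _]].
by case/andP=> /andP[_ jU] _; rewrite (disjointFr dTU jT) in jU.
Qed.

Lemma ext_sign_cocycle S T U :
  ext_sign S T * ext_sign (S :|: T) U = ext_sign T U * ext_sign S (T :|: U).
Proof.
rewrite /ext_sign -!setI_eq0 setIUl setIUr !setU_eq0 !setI_eq0.
case dST: [disjoint S & T]; case dSU: [disjoint S & U];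
  case dTU: [disjoint T & U]; rewrite /= ?mul0r ?mulr0 //.
rewrite inversionsUl // inversionsUr // -!exprD; congr (_ ^+ _).
by rewrite addnA [RHS]addnC.
Qed.

Lemma ext_mulA : associative ext_mul.
Proof.
move=> f g h.
have AM S T U : ext_mul (ext_mono S) (ext_mul (ext_mono T) (ext_mono U)) =
                ext_mul (ext_mul (ext_mono S) (ext_mono T)) (ext_mono U).
  rewrite !(ext_mul_mono, ext_mulZl, ext_mulZr) !scalerA setUA.
  by rewrite ext_sign_cocycle.
rewrite (ext_mulEl f (ext_mul g h)) (ext_mulEl f g) ext_mul_suml.
apply: eq_bigr => S _; rewrite ext_mulZl; congr (f S *: (_ : E)).
rewrite (ext_mulEl g h) (ext_mulEr _ g) ext_mul_suml ext_mul_sumr.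
apply: eq_bigr => T _; rewrite ext_mulZl ext_mulZr; congr (g T *: (_ : E)).
rewrite (ext_mulEr _ h) (ext_mulEr (ext_mul _ _) h) ext_mul_sumr.
by apply: eq_bigr => U _; rewrite ext_mulZr AM.
Qed.

Lemma inversions0l S : inversions set0 S = 0%N.
Proof. by apply: eq_card0 => p; rewrite !inE. Qed.

Lemma inversions0r S : inversions S set0 = 0%N.
Proof. by apply: eq_card0 => p; rewrite !inE andbF. Qed.

Lemma ext_mul1l : left_id (ext_mono set0) ext_mul.
Proof.
move=> f; rewrite ext_mulEr [RHS]ext_monoE.
apply: eq_bigr => S _; rewrite ext_mul_mono set0U /ext_sign.
by rewrite -setI_eq0 set0I eqxx inversions0l scale1r.
Qed.

Lemma ext_mul1r : right_id (ext_mono set0) ext_mul.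
Proof.
move=> f; rewrite ext_mulEl [RHS]ext_monoE.
apply: eq_bigr => S _; rewrite ext_mul_mono setU0 /ext_sign.
by rewrite -setI_eq0 setI0 eqxx inversions0r scale1r.
Qed.

Lemma ext_oner_neq0 : ext_mono set0 != 0.
Proof.
by apply/eqP=> /ffunP/(_ set0); rewrite !ffunE eqxx; apply/eqP; rewrite oner_eq0.
Qed.

HB.instance Definition _ := GRing.Zmodule_isNzRing.Build E
  ext_mulA ext_mul1l ext_mul1r ext_mulDl ext_mulDr ext_oner_neq0.

Lemma ext_scaleAl (a : K) (f g : E) : a *: (f * g) = (a *: f) * g.
Proof. by rewrite -[LHS]ext_mulZl. Qed.

HB.instance Definition _ := GRing.Lmodule_isLalgebra.Build K E ext_scaleAl.

Lemma ext_scaleAr (a : K) (f g : E) : a *: (f * g) = f * (a *: g).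
Proof. by rewrite -[LHS]ext_mulZr. Qed.

HB.instance Definition _ := GRing.Lalgebra_isAlgebra.Build K E ext_scaleAr.

Definition ext_gen (i : 'I_n) : E := ext_mono [set i].

Lemma ext_gen_mul (i j : 'I_n) :
  (i < j)%N -> ext_gen i * ext_gen j = ext_mono [set i; j].
Proof.
move=> ltij; rewrite [LHS]ext_mul_mono /ext_sign disjoints1 inE.
rewrite neq_ltn ltij /inversions eq_card0 ?scale1r // => -[a b].
rewrite !inE /=; apply/negP=> /andP[/andP[/eqP-> /eqP->]].
by rewrite ltnNge ltnW.
Qed.

Lemma ext_gen_sqr (i : 'I_n) : ext_gen i * ext_gen i = 0.
Proof.
by rewrite [LHS]ext_mul_mono /ext_sign disjoints1 inE eqxx scale0r.
Qed.

Lemma ext_gen_anticomm (i j : 'I_n) :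
  ext_gen j * ext_gen i = - (ext_gen i * ext_gen j).
Proof.
wlog ltij : i j / (i < j)%N => [W|].
  case: (ltngtP i j) => [/W//|/W->|/val_inj->]; first by rewrite opprK.
  by rewrite ext_gen_sqr oppr0.
rewrite (ext_gen_mul ltij) [LHS]ext_mul_mono /ext_sign disjoints1 inE.
rewrite neq_ltn ltij orbT setUC.
suff ->: inversions [set j] [set i] = 1%N by rewrite expr1 scaleN1r.
rewrite /inversions -(cards1 (j, i)); apply: eq_card => -[a b].
rewrite !inE xpair_eqE /=; case: eqP => //= ->; case: eqP => //= ->.
exact: ltij.
Qed.

End Exterior.

Section Gin.
Variables (K : fieldType) (n : nat).
Notation E := (exterior K n).

Definition is_ideal (I : E -> Prop) : Prop :=
  [/\ I 0, forall f g, I f -> I g -> I (f + g)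
    & forall f g, I g -> I (f * g) /\ I (g * f)].

Definition ideal_gen (X : E -> Prop) : E -> Prop :=
  fun f => forall I, is_ideal I -> (forall g, X g -> I g) -> I f.

(* The algebra endomorphism e_j |-> \sum_i a_ij e_i. *)
Definition ext_act (a : 'M[K]_n) (f : E) : E :=
  \sum_(S : {set 'I_n})
    f S *: \prod_(j <- enum S) \sum_i a i j *: ext_gen K i.

Definition ext_image (a : 'M[K]_n) (J : E -> Prop) : E -> Prop :=
  fun f => exists2 h, J h & f = ext_act a h.

(* [revlex_lt S T] states that e_S is smaller than e_T in the degree reverse
   lexicographic order for which e_0 is the smallest variable: among monomials
   of the same degree, the smaller one contains the smallest variable on which
   they differ. *)
Definition revlex_lt (S T : {set 'I_n}) : bool :=
  (#|S| < #|T|)%N ||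
  (#|S| == #|T|) &&
  [exists i, [&& i \in S, i \notin T &
     [forall j : 'I_n, (j < i)%N ==> ((j \in S) == (j \in T))]]].

Definition is_initial (f : E) (S : {set 'I_n}) : Prop :=
  f S != 0 /\ forall T, f T != 0 -> T != S -> revlex_lt T S.

Definition initial_ideal (J : E -> Prop) : E -> Prop :=
  ideal_gen (fun m => exists f S,
    [/\ J f, is_initial f S & m = ext_mono K S]).

(* Zariski open subsets of GL_n(K), the polynomials being in the n * n matrix
   entries. *)
Definition zariski_open (U : 'M[K]_n -> Prop) : Prop :=
  exists P : {mpoly K[n * n]} -> Prop, forall a, U a <->
    a \in unitmx /\ exists2 p, P p & p.@[fun k => mxvec a 0 k] != 0.

Definition is_gin (J I : E -> Prop) : Prop :=
  exists U : 'M[K]_n -> Prop,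
    [/\ zariski_open U, exists a, U a
      & forall a, U a -> forall f, initial_ideal (ext_image a J) f <-> I f].

Definition face_ideal (G : {set {set 'I_n}}) : E -> Prop :=
  ideal_gen (fun m =>
    (exists i j, [/\ i != j, [set i; j] \notin G
                   & m = ext_gen K i * ext_gen K j]) \/
    (exists2 S : {set 'I_n}, #|S| = 3 & m = ext_mono K S)).

(* [D] is the edge set of the exterior shifted graph of [G] over [K]. *)
Definition exterior_shifted (G D : {set {set 'I_n}}) : Prop :=
  simple_graph D /\
  exists2 I, is_gin (face_ideal G) I &
    forall i j, i != j ->
      ([set i; j] \in D <-> ~ I (ext_gen K i * ext_gen K j)).

End Gin.

(* Main.v *)
(* Let b_v be the number of later neighbours of v in a perfect elimination
   ordering of G, and let D be the graph whose k-th row {k, k+1}, {k, k+2}, ...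
   has as many edges as there are v with b_v >= k.

   A vertex w outside {i, j} that is simplicial in a graph is still simplicial
   with the same degree after Shift_ij, and by Dirac's theorem such a w exists if
   the shift is an edge shift or a disjoint shift; so these shifts preserve the
   multiset of the b_v, and deleting a star vertex lowers the positive b_v by
   one. Hence every run of the algorithm returns D, and D is reached from G by
   shifts.

   For the exterior shifting, consider the skew forms supported on the edges of
   G. A shift is a degeneration of a linear substitution, so the products
   f_p f_q of generic linear forms over the edges pq of D are linearly
   independent modulo J_G, as they are modulo J_D. On the other hand each v with
   b_v > k contributes, through the clique formed by v and its later neighbours,
   b_v - k independent forms annihilated by f_1, ..., f_k. By the choice of D
   these two bounds meet, so the pairs of D are exactly the standard ones. *)
From HB Require Import structures.
Require Import Defs.
From mathcomp Require Import all_boot all_order all_algebra.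
From mathcomp Require Import mpoly zify ring.
Set Implicit Arguments.
Unset Strict Implicit.
Unset Printing Implicit Defensive.

(** * Combinatorial shifts *)

(** A run of the algorithm is not literally a sequence of shifts of [G]: phase III records an
    interval in place of the true neighbourhood of [u]. The run and the shift sequence are therefore
    handled separately and compared only through the counts [r], which determine the output. On the
    exterior side, put b = a^-1 and let f_p be its columns; then f lies in a(J_G) iff the
    substitution by b makes its coefficients at the edges of G vanish. Independence of the products
    over D gives a basis modulo J_G, because |G| = |D|, but not yet the standard basis: a pair
    outside D must reduce to pairs of D in rows no later than its own. Dually, a form on the edges
    of G that vanishes at f_p f_q for all edges pq of D with p < k must vanish at f_p f_q for every
    p < k and every q. The stresses give this, since the truncated sum of the b_v - k is at least
    the number of edges of D in the rows from k on. Characteristic 0 supplies enough scalars to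
    specialise polynomials and allows division by 2. *)

Section Shift.
Variable n : nat.
Implicit Types (E H G D : {set {set 'I_n}}) (S T : {set 'I_n}) (i j u v x y : 'I_n).

Lemma adj_sym H x y : adj H x y = adj H y x.
Proof. by rewrite /adj setUC. Qed.

Lemma adj_neq H x y : simple_graph H -> adj H x y -> x != y.
Proof.
move=> /forall_inP sH /sH; rewrite cards2; by case: (x =P y).
Qed.

Lemma adjxx H x : simple_graph H -> adj H x x = false.
Proof. by move=> sH; apply/negP=> /(adj_neq sH); rewrite eqxx. Qed.

Lemma swap_setK i j S : j \in S -> i \notin S -> j |: ((i |: (S :\ j)) :\ i) = S.
Proof.
move=> jS iS; apply/setP=> z; rewrite !inE.
case: (z =P j) => [->|_] /=; first by rewrite jS.
case: (z =P i) => [->|_] //=; first by rewrite (negbTE iS).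
Qed.

Lemma card_swap_set i j S : j \in S -> i \notin S -> #|i |: (S :\ j)| = #|S|.
Proof.
move=> jS iS; rewrite cardsU1 !inE (negbTE iS) andbF /= add1n.
by rewrite (cardsD1 j S) jS.
Qed.

(** A moved face lands outside [H], so it cannot collide with a fixed one, and the swap of [j] for
    [i] can be undone. *)
Lemma shift_face_inj i j H : {in H &, injective (shift_face i j H)}.
Proof.
move=> S T SH TH; rewrite /shift_face.
case: ifP => [/and3P[jS iS nS]|_]; case: ifP => [/and3P[jT iT nT]|_] //.
- by move=> eq; rewrite -(swap_setK jS iS) eq swap_setK.
- by move=> eq; rewrite eq TH in nS.
- by move=> eq; rewrite -eq SH in nT.
Qed.

Lemma card_shift i j H : #|shift i j H| = #|H|.
Proof. exact: card_in_imset (@shift_face_inj i j H). Qed.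

Lemma simple_shift i j H : simple_graph H -> simple_graph (shift i j H).
Proof.
move=> /forall_inP sH; apply/forall_inP=> _ /imsetP[S SH ->].
rewrite /shift_face; case: ifP => [/and3P[jS iS _]|_]; last exact: sH.
by rewrite card_swap_set //; apply: sH.
Qed.

Lemma shift_id i j H S : S \in H -> ~~ ((j \in S) && (i \notin S)) -> S \in shift i j H.
Proof.
move=> SH nji; apply/imsetP; exists S => //.
by rewrite /shift_face andbA (negbTE nji).
Qed.

Lemma shift_id_inv i j H S : S \in shift i j H -> ~~ ((i \in S) && (j \notin S)) -> S \in H.
Proof.
move=> /imsetP[T TH ->]; rewrite /shift_face; case: ifP => // /and3P[jT iT _].
rewrite !inE !eqxx /= orbF => /negbNE/eqP eij.
by rewrite -eij jT in iT.
Qed.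

Lemma adj_shift_other i j H x y :
  x != i -> x != j -> y != i -> y != j -> adj (shift i j H) x y = adj H x y.
Proof.
move=> xi xj yi yj; apply/idP/idP => [/shift_id_inv|/shift_id]; apply.
  by rewrite !inE (eq_sym i x) (negbTE xi) (eq_sym i y) (negbTE yi).
by rewrite !inE (eq_sym j x) (negbTE xj) (eq_sym j y) (negbTE yj).
Qed.

Lemma adj_shift_ij i j H : adj (shift i j H) i j = adj H i j.
Proof.
apply/idP/idP => [/shift_id_inv|/shift_id]; apply.
  by rewrite !inE !eqxx orbT.
by rewrite !inE !eqxx /= andbF.
Qed.

Lemma swap_pair i j x : x != i -> x != j -> i |: ([set j; x] :\ j) = [set i; x].
Proof.
move=> xi xj; apply/setP=> z; rewrite !inE; case: (z =P j) => //= ->.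
by rewrite (eq_sym j x) (negbTE xj).
Qed.

(** Together with [adj_shift_r]: at a third vertex, the adjacencies to [i] and [j] become their
    disjunction and conjunction, which is why its degree does not change. *)
Lemma adj_shift_l i j H x : i != j -> x != i -> x != j ->
  adj (shift i j H) i x = adj H i x || adj H j x.
Proof.
move=> ij xi xj; apply/idP/orP.
  move=> /imsetP[T TH]; rewrite /shift_face; case: ifP => [/and3P[jT iT _]|_ eT].
    move=> eT; right; move: TH; rewrite -(swap_setK jT iT) -eT swap_pair //.
  by left; rewrite /adj eT.
case=> [aix|ajx].
  by apply: shift_id => //; rewrite !inE eqxx andbF.
case aix: (adj H i x).
  by apply: shift_id => //; rewrite !inE eqxx andbF.
apply/imsetP; exists [set j; x] => //.
by rewrite /shift_face swap_pair // -/(adj H i x) aix !inE eqxx /= (negbTE ij) (eq_sym i x) (negbTE xi).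
Qed.

Lemma adj_shift_r i j H x : i != j -> x != i -> x != j ->
  adj (shift i j H) j x = adj H j x && adj H i x.
Proof.
move=> ij xi xj; apply/idP/andP.
  move=> a; have ajx: adj H j x.
    by apply: (shift_id_inv a); rewrite !inE (negbTE ij) (eq_sym i x) (negbTE xi).
  split=> //.
  case aix: (adj H i x) => //.
  move: a => /imsetP[T TH].
  rewrite /shift_face; case: ifP => [/and3P[jT iT nT]|/negP H1 eT].
    by move=> /setP/(_ i); rewrite !inE eqxx (negbTE ij) (eq_sym i x) (negbTE xi).
  case: H1; rewrite -eT swap_pair // -/(adj H i x) aix.
  by rewrite !inE eqxx (negbTE ij) (eq_sym i x) (negbTE xi).
case=> ajx aix; apply/imsetP; exists [set j; x] => //.
by rewrite /shift_face swap_pair // -/(adj H i x) aix /= !andbF.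
Qed.

End Shift.

(** * Perfect elimination orderings *)

Section Peo.
Variable T : eqType.
Implicit Types (e : rel T) (s t vs : seq T) (u v w x y : T).

Definition simplicial e w t : Prop :=
  forall x y, x \in t -> y \in t -> e w x -> e w y -> x != y -> e x y.

Fixpoint peo e vs : Prop :=
  if vs is v :: t then simplicial e v t /\ peo e t else True.

Fixpoint backdeg e vs : seq nat :=
  if vs is v :: t then count (e v) t :: backdeg e t else [::].

Lemma sub_simplicial e w s t :
  {subset s <= t} -> simplicial e w t -> simplicial e w s.
Proof. by move=> st sw x y /st xt /st yt; apply: sw. Qed.

Lemma simplicial_cons e w x t :
  ~~ e w x -> simplicial e w t -> simplicial e w (x :: t).
Proof.
move=> nwx sw y z; rewrite !inE.
case: (y =P x) => [->|_] /=; first by rewrite (negbTE nwx).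
by case: (z =P x) => [->|_] /=; [rewrite (negbTE nwx) | apply: sw].
Qed.

Lemma eq_peo e e' vs : {in vs &, e =2 e'} -> peo e vs -> peo e' vs.
Proof.
elim: vs => //= v t IH ee [sv pt]; split; last first.
  by apply: IH pt => x y xt yt; apply: ee; rewrite inE ?xt ?yt orbT.
move=> x y xt yt.
rewrite -!ee ?inE ?eqxx ?xt ?yt ?orbT //; exact: sv.
Qed.

Lemma eq_backdeg e e' vs : {in vs &, e =2 e'} -> backdeg e vs = backdeg e' vs.
Proof.
elim: vs => //= v t IH ee; congr (_ :: _).
  by apply: eq_in_count => x xt; apply: ee; rewrite inE ?eqxx ?xt ?orbT.
by apply: IH => x y xt yt; apply: ee; rewrite inE ?xt ?yt orbT.
Qed.

Lemma peo_filter e (p : pred T) vs : peo e vs -> peo e (filter p vs).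
Proof.
elim: vs => //= v t IH [sv pt]; case: ifP => _ /=; last exact: IH.
split; last exact: IH.
by apply: sub_simplicial sv => x; rewrite mem_filter => /andP[].
Qed.

Variables (e : rel T).
Hypotheses (e_sym : ssrbool.symmetric e) (e_irr : irreflexive e).

(** The head [x0] sees a clique, so of two non-adjacent simplicial vertices of the tail it misses at
    least one, and is paired with that one. If the tail is complete, any vertex missed by [x0] will
    do. *)
Lemma peo_dirac vs : uniq vs -> peo e vs ->
  (forall x y, x \in vs -> y \in vs -> x != y -> e x y) \/
  exists s t : T, [/\ s \in vs, t \in vs, s != t, ~~ e s t
                & simplicial e s vs /\ simplicial e t vs].
Proof.
elim: vs => [|x0 t IH] /=; first by left.
case/andP=> x0t ut [s0 pt].
have S0 : simplicial e x0 (x0 :: t) by apply: simplicial_cons; rewrite ?e_irr.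
case: (IH ut pt) => [cpl|[s [u [st ut' su nesu [ss sus]]]]]; last first.
  right; wlog ne : s u st ut' su nesu ss sus / ~~ e x0 s => [W|].
    case e0s: (e x0 s); last by apply: (W s u) => //; rewrite e0s.
    apply: (W u s) => //; rewrite 1?eq_sym 1?e_sym //.
    by apply: contra nesu => e0u; apply: s0 => //; rewrite e_sym.
  exists x0, s; rewrite !inE eqxx st orbT ne; split=> //.
    by apply: contraNneq x0t => ->.
  by split=> //; apply: simplicial_cons => //; rewrite e_sym.
case: (altP (@allP _ (e x0) t)) => [all0|].
  left => x y; rewrite !inE => /orP[/eqP->|xt] /orP[/eqP->|yt]; rewrite ?eqxx // => ne.
  - exact: all0.
  - by rewrite e_sym all0.
  - exact: cpl.
case/allPn=> y yt ne; right; exists x0, y; rewrite !inE eqxx yt orbT ne; split=> //.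
  by apply: contraNneq x0t => ->.
split=> //; apply: simplicial_cons; first by rewrite e_sym.
by move=> x z xt zt _ _; apply: cpl.
Qed.

Lemma peo_simplicial_neq vs x : uniq vs -> peo e vs -> has (predC1 x) vs ->
  exists w, [/\ w \in vs, w != x & simplicial e w vs].
Proof.
move=> uvs pvs /hasP[w wvs /= wx].
case: (peo_dirac uvs pvs) => [cpl|[s [t [sv tv st _ [ss tt]]]]].
  by exists w; split=> // y z yv zv _ _; apply: cpl.
by case: (altP (s =P x)) => sx; [exists t; split; rewrite -?sx 1?eq_sym | exists s].
Qed.

(** Two non-adjacent simplicial vertices cannot both be endpoints of the edge. *)
Lemma peo_simplicial_edge vs x y : uniq vs -> peo e vs -> e x y ->
  has (predC (pred2 x y)) vs ->
  exists w, [/\ w \in vs, w != x, w != y & simplicial e w vs].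
Proof.
move=> uvs pvs exy /hasP[w wvs]; rewrite /= negb_or => /andP[wx wy].
case: (peo_dirac uvs pvs) => [cpl|[s [t [sv tv st nst [ss tt]]]]].
  by exists w; split=> // a b av bv _ _; apply: cpl.
have [s2|] := boolP ((s == x) || (s == y)); last first.
  by rewrite negb_or => /andP[sx sy]; exists s.
exists t; split=> //.
- apply: contraNneq nst => tx; rewrite tx in st *.
  by move: s2; rewrite (negbTE st) /= => /eqP->; rewrite e_sym.
- apply: contraNneq nst => ty; rewrite ty in st *.
  by move: s2; rewrite (negbTE st) orbF => /eqP->.
Qed.

(* [C] separates [x] from [y]: a simplicial vertex of the part of the graph
   inside [C], or outside [C], is simplicial in the whole graph. *)
Lemma peo_simplicial_sep (C : pred T) vs x y : uniq vs -> peo e vs ->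
  (forall a b, e a b -> C a = C b) -> C y -> ~~ C x ->
  has (predC (pred2 x y)) vs ->
  exists w, [/\ w \in vs, w != x, w != y & simplicial e w vs].
Proof.
move=> uvs pvs eC Cy Cx /hasP[w wvs]; rewrite /= negb_or => /andP[wx wy].
(* Only the side of [w] is kept; [z] is the one of [x], [y] lying on it, hence the only one to
   avoid. *)
pose p a := C a == C w; pose z := if C w then y else x.
have hz : has (predC1 z) (filter p vs).
  apply/hasP; exists w; first by rewrite mem_filter /p eqxx.
  by rewrite /= /z; case: ifP.
have [a [av az sa]] := peo_simplicial_neq (filter_uniq p uvs) (peo_filter p pvs) hz.
move: av; rewrite mem_filter => /andP[/eqP pa av].
exists a; split=> //.
- by move: az pa; rewrite /z; case: (C w) => // _ Ca; apply: contraNneq Cx => <-; rewrite Ca.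
- by move: az pa; rewrite /z; case: (C w) => // _ Ca; apply: contraFneq Ca => ->.
move=> b c bv cv eab eac; apply: sa => //; rewrite mem_filter ?bv ?cv andbT.
  by rewrite /p -(eC _ _ eab) pa.
by rewrite /p -(eC _ _ eac) pa.
Qed.

(** Elimination may start at any simplicial vertex. Carrying [w] past the head [x] changes no
    back-degree if they are not adjacent; if they are, both being simplicial forces their other
    later neighbours to coincide, and the two back-degrees are merely interchanged. *)
Lemma peo_exchange vs w : uniq vs -> peo e vs -> w \in vs -> simplicial e w vs ->
  exists t, [/\ perm_eq (w :: t) vs, peo e (w :: t)
              & perm_eq (backdeg e (w :: t)) (backdeg e vs)].
Proof.
elim: vs => //= x vs IH /andP[xvs uvs] [sx pvs].
rewrite inE; case: (altP (w =P x)) => [-> _ _|wx /= wvs sw].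
  by exists vs.
have sw' : simplicial e w vs by apply: sub_simplicial sw => a; rewrite inE orbC => ->.
have [t /= [pt [swt pet] bt]] := IH uvs pvs wvs sw'.
have tvs a : a \in t -> a \in vs by rewrite -(perm_mem pt) inE orbC => ->.
exists (x :: t); split=> /=.
- rewrite (perm_catCA [:: w] [:: x] t) /= perm_cons; exact: pt.
- split; last by split=> //; apply: sub_simplicial sx.
  apply: sub_simplicial sw => a; rewrite !inE => /orP[->//|/tvs ->]; exact: orbT.
have ew : count (e x) vs = (e x w + count (e x) t)%N by rewrite -(permP pt).
rewrite ew (e_sym w x); case exw: (e x w) => /=; last first.
  rewrite (perm_catCA [:: _] [:: _] _) /= perm_cons; exact: bt.
suff ewx : count (e w) t = count (e x) t.
  by rewrite ewx perm_cons; apply: perm_trans bt; rewrite /= ewx.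
apply: eq_in_count => a at_; apply/idP/idP => ea.
  apply: sw; rewrite ?inE ?eqxx ?(tvs _ at_) ?orbT ?(e_sym w x) //.
  by apply: contraNneq xvs => ->; apply: tvs.
apply: sx => //; first exact: tvs.
have : uniq (w :: t) by rewrite (perm_uniq pt).
by move=> /= /andP[wt _]; apply: contraNneq wt => ->.
Qed.

End Peo.

(** * Back-degrees under shifts and under deletion of a star vertex *)

Section PeoShift.
Variable n : nat.
Implicit Types (E H G D : {set {set 'I_n}}) (V S : {set 'I_n}) (i j u v w x y : 'I_n).
Implicit Types (vs t : seq 'I_n) (r : nat -> nat).

(** If [w] sees one of [i], [j], its other neighbours see the same one, hence see [i] after the
    shift; if [w] sees both, so do they, and they see [j] after the shift. These are the cases in
    which [w] itself sees [i], respectively [j], afterwards. *)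
Lemma simplicial_shift H i j w t : i != j -> w != i -> w != j ->
  i \in t -> j \in t -> simplicial (adj H) w t -> simplicial (adj (shift i j H)) w t.
Proof.
move=> ij wi wj it jt sw.
have sh x : x != i -> x != j -> adj (shift i j H) w x = adj H w x.
  by move=> xi xj; rewrite adj_shift_other.
have shi : adj (shift i j H) w i = adj H w i || adj H w j.
  by rewrite adj_sym adj_shift_l // ![adj H _ w]adj_sym.
have shj : adj (shift i j H) w j = adj H w j && adj H w i.
  by rewrite adj_sym adj_shift_r // ![adj H _ w]adj_sym.
have Ai y : y \in t -> y != i -> y != j -> adj H w i || adj H w j -> adj H w y ->
    adj (shift i j H) i y.
  move=> yt yi yj wij wy; rewrite adj_shift_l //.
  by case/orP: wij => wz; apply/orP; [left|right]; apply: sw => //; rewrite eq_sym.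
have Aj y : y \in t -> y != i -> y != j -> adj H w j && adj H w i -> adj H w y ->
    adj (shift i j H) j y.
  move=> yt yi yj /andP[wj' wi'] wy; rewrite adj_shift_r //.
  by apply/andP; split; apply: sw => //; rewrite eq_sym.
move=> x y xt yt; case: (altP (x =P i)) => [->|xi]; first rewrite shi.
  case: (altP (y =P i)) => [->|yi]; first by rewrite eqxx.
  case: (altP (y =P j)) => [->|yj]; last by rewrite sh // => *; apply: Ai.
  by rewrite shj adj_shift_ij => _ /andP[? ?] _; apply: sw.
case: (altP (x =P j)) => [->|xj]; first rewrite shj.
  case: (altP (y =P j)) => [->|yj]; first by rewrite eqxx.
  case: (altP (y =P i)) => [->|yi]; last by rewrite sh // => *; apply: Aj.
  by move=> /andP[? ?] _ _; rewrite adj_sym adj_shift_ij; apply: sw.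
rewrite sh //; case: (altP (y =P i)) => [->|yi].
  by rewrite shi => *; rewrite adj_sym; apply: Ai.
case: (altP (y =P j)) => [->|yj].
  by rewrite shj => *; rewrite adj_sym; apply: Aj.
by rewrite sh // adj_shift_other //; apply: sw.
Qed.

Lemma count_adj_shift H i j w t : i != j -> w != i -> w != j -> uniq t ->
  i \in t -> j \in t -> count (adj (shift i j H) w) t = count (adj H w) t.
Proof.
move=> ij wi wj ut it jt.
have jt' : j \in rem i t by rewrite mem_rem_uniq // inE eq_sym ij.
have pt : perm_eq t (i :: j :: rem j (rem i t)).
  by apply: perm_trans (perm_to_rem it) _; rewrite perm_cons perm_to_rem.
rewrite !(permP pt) /=.
rewrite (adj_sym _ w i) (adj_sym _ w j) adj_shift_l // adj_shift_r // ![adj H _ w]adj_sym.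
rewrite !addnA; congr (_ + _)%N; first by case: (adj H w i); case: (adj H w j).
apply: eq_in_count => x xt; rewrite adj_shift_other //.
  by move: xt; rewrite mem_rem_uniq ?rem_uniq // inE mem_rem_uniq // inE => /and3P[].
by move: xt; rewrite mem_rem_uniq ?rem_uniq // inE => /andP[].
Qed.

Lemma peo_shift H i j vs : simple_graph H ->
  edge_shift H i j || (disjoint_shift H i j && (i != j)) ->
  uniq vs -> i \in vs -> j \in vs -> peo (adj H) vs ->
  exists vs', [/\ perm_eq vs' vs, peo (adj (shift i j H)) vs'
    & perm_eq (backdeg (adj (shift i j H)) vs') (backdeg (adj H) vs)].
Proof.
move=> sH good.
have sym := @adj_sym n H; have irr : irreflexive (adj H) by move=> x; apply: adjxx.
have ij : i != j by case/orP: good => [/(adj_neq sH)//|/andP[]].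
have [m] := ubnP (size vs); elim: m vs => // m IH vs sz uvs ivs jvs pvs.
case has_o : (has (predC (pred2 i j)) vs); last first.
  have cl x : x \in vs -> (x == i) || (x == j).
    by move=> xvs; apply/negPn/negP=> nx; move/hasPn: (negbT has_o) => /(_ x xvs) /=; rewrite nx.
  (* When only [i] and [j] are left, the shift changes nothing between them. *)
  have ee : {in vs &, adj H =2 adj (shift i j H)}.
    move=> x y /cl xij /cl yij.
    case: (altP (x =P y)) => [->|xy]; first by rewrite !adjxx ?simple_shift.
    case/orP: xij xy => /eqP->; case/orP: yij => /eqP->; rewrite ?eqxx // => _.
      by rewrite adj_shift_ij.
    by rewrite adj_sym [RHS]adj_sym adj_shift_ij.
  exists vs; split=> //; first exact: eq_peo pvs.
  by rewrite (eq_backdeg ee).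
have [w [wvs wi wj sw]] : exists w, [/\ w \in vs, w != i, w != j & simplicial (adj H) w vs].
  case/orP: good => [ed|/andP[dis _]]; first exact: (peo_simplicial_edge sym irr uvs pvs ed).
  apply: (peo_simplicial_sep sym irr (C := connect (adj H) j) uvs pvs) => //.
  - move=> a b ab; apply: same_connect_r; last exact: connect1.
    exact: sym_connect_sym.
  - by rewrite sym_connect_sym.
have [t [pt [swt pet] bt]] := peo_exchange sym uvs pvs wvs sw.
have uwt : uniq (w :: t) by rewrite (perm_uniq pt).
have in_t x : x != w -> x \in vs -> x \in t.
  by move=> xw; rewrite -(perm_mem pt) inE (negbTE xw).
have it : i \in t by apply: in_t => //; rewrite eq_sym.
have jt : j \in t by apply: in_t => //; rewrite eq_sym.
have ut : uniq t by case/andP: uwt.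
have szt : (size t < m)%N by move: sz; rewrite -(perm_size pt) /= ltnS.
have [t' [pt' pet' bt']] := IH t szt ut it jt pet.
exists (w :: t'); split.
- by apply: perm_trans pt; rewrite perm_cons.
- split=> //; apply: (sub_simplicial (t := t)); last exact: simplicial_shift.
  by move=> x; rewrite (perm_mem pt').
- apply: perm_trans bt; rewrite /= (permP pt') count_adj_shift // perm_cons; exact: bt'.
Qed.

(** The star vertex can be eliminated last. A vertex other than [u] that has a neighbour sees [u],
    so a positive back-degree drops by exactly one when [u] is removed, and the positive
    back-degrees belong to the neighbours of [u]. The back-degree 0 of [u] itself is invisible to
    the counts. *)
Lemma peo_star H u vs : simple_graph H -> uniq vs -> u \in vs -> peo (adj H) vs ->
  (forall x y, x \in vs -> y \in vs -> adj H x y -> x != u -> adj H x u) ->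
  exists vs', [/\ perm_eq (u :: vs') vs, peo (adj H) vs',
     forall k, count (ltn k) (backdeg (adj H) vs') = count (ltn k.+1) (backdeg (adj H) vs)
   & count (ltn 0) (backdeg (adj H) vs) = count (adj H u) vs].
Proof.
move=> sH.
have sym := @adj_sym n H; have irr : irreflexive (adj H) by move=> x; apply: adjxx.
have [m] := ubnP (size vs); elim: m vs => // m IH vs sz uvs uvs' pvs st.
case has_o : (has (predC1 u) vs); last first.
  have {}cl : all (pred1 u) vs.
    by apply/allP=> x xvs; apply/negPn/negP=> nx; move/hasPn: (negbT has_o) => /(_ x xvs) /=; rewrite nx.
  move: cl => /all_pred1P evs; exists [::].
  have -> : vs = [:: u].
    move: evs uvs uvs'; rewrite -[size vs]/(size vs).
    by case: (size vs) => [|[|k]] -> //=; rewrite inE eqxx.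
  by split=> //=; rewrite irr.
have [w [wvs wu sw]] := peo_simplicial_neq sym irr uvs pvs has_o.
have [t [pt [swt pet] bt]] := peo_exchange sym uvs pvs wvs sw.
have uwt : uniq (w :: t) by rewrite (perm_uniq pt).
have tvs x : x \in t -> x \in vs by rewrite -(perm_mem pt) inE orbC => ->.
have ut : u \in t by rewrite -(perm_mem pt) inE eq_sym (negbTE wu) in uvs'.
have unt : uniq t by case/andP: uwt.
have szt : (size t < m)%N by move: sz; rewrite -(perm_size pt) /= ltnS.
have stt x y : x \in t -> y \in t -> adj H x y -> x != u -> adj H x u.
  by move=> xt yt; apply: st; apply: tvs.
have [t' [pt' pet' ct' c0]] := IH t szt unt ut pet stt.
exists (w :: t'); split.
- apply: perm_trans pt; rewrite (perm_catCA [:: u] [:: w] t') /= perm_cons; exact: pt'.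
- split=> //; apply: sub_simplicial swt => x xt'; rewrite -(perm_mem pt') inE xt'; exact: orbT.
- move=> k; rewrite -(permP bt) /= ct' -(permP pt') /=.
  case wau: (adj H w u) => //=; rewrite add0n.
  suff -> : count (adj H w) t' = 0 by [].
  apply/eqP; rewrite eqn0Ngt -has_count; apply/hasPn=> x xt'.
  apply: contraFN wau => wx; apply: (st w x) => //; apply: tvs.
  by rewrite -(perm_mem pt') inE xt' orbT.
- rewrite -(permP bt) -(permP pt) /= c0; congr (_ + _)%N; rewrite adj_sym.
  rewrite -has_count; congr nat_of_bool; apply/hasP/idP => [[x xt wx]|wau].
    by apply: (st w x) => //; apply: tvs.
  by exists u.
Qed.

(** The later neighbours of [v] form a clique, so the first of them sees all the others. *)
Lemma simplicial_backdeg (e : rel 'I_n) v t :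
  uniq t -> simplicial e v t -> peo e t -> (0 < count (e v) t)%N ->
  has (leq (count (e v) t).-1) (backdeg e t).
Proof.
elim: t => //= w t IH /andP[wt ut] sv [sw pt]; case vw: (e v w) => /=; last first.
  move=> c; apply/orP; right; apply: IH => //.
  by apply: sub_simplicial sv => x; rewrite inE orbC => ->.
move=> _; apply/orP; left.
rewrite (@eq_in_count _ _ (predI (e v) (e w))); first by apply: sub_count => x /andP[].
move=> x xt /=; case vx: (e v x) => //=; apply/esym.
by apply: sv; rewrite ?inE ?eqxx ?xt ?orbT //; apply: contraNneq wt => ->.
Qed.

(** Back-degrees leave no gaps: the last vertex whose back-degree exceeds [k.+1] is followed, by
    [simplicial_backdeg], by one of back-degree exactly [k.+1], which only the right-hand side
    counts. *)
Lemma backdeg_gap (e : rel 'I_n) vs k : uniq vs -> peo e vs ->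
  (0 < count (ltn k.+1) (backdeg e vs))%N ->
  (count (ltn k.+1) (backdeg e vs) < count (ltn k) (backdeg e vs))%N.
Proof.
move=> uvs pvs c0.
have : has (pred1 k.+1) (backdeg e vs).
  elim: vs uvs pvs c0 => //= v t IH /andP[vt ut] [sv pt].
  case: (posnP (count (ltn k.+1) (backdeg e t))) => [ct0|/(IH ut pt) -> _]; last exact: orbT.
  rewrite ct0 addn0 lt0b => kc.
  have := simplicial_backdeg ut sv pt (leq_ltn_trans (leq0n _) kc).
  case/hasP=> d dt cd; apply/orP; right; apply/hasP; exists d => //.
  have : ~~ (k.+1 < d)%N.
    by apply/negP=> kd; move: ct0; apply/eqP; rewrite -lt0n -has_count; apply/hasP; exists d.
  by rewrite /= -leqNgt => dk; apply/eqP; lia.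
elim: (backdeg e vs) => //= c b IH; case: eqP => [-> _|_ /= /IH]; last by lia.
have := @sub_count _ (ltn k.+1) (ltn k) (fun (x : nat) (h : (k.+1 < x)%N) => ltnW h) b.
by rewrite /=; lia.
Qed.

(** Vertices are numbered from 0, so row [k] collects the back-degrees strictly above [k]: [r] is
    the conjugate partition of the back-degrees. The ordering is existential because shifts change
    it while [r] stays. *)
Definition chordal_rows H V r : Prop :=
  exists vs, [/\ uniq vs, vs =i V, peo (adj H) vs
    & forall k, count (ltn k) (backdeg (adj H) vs) = r k].

Lemma chordal_rows_shift H V r i j : simple_graph H ->
  edge_shift H i j || (disjoint_shift H i j && (i != j)) -> i \in V -> j \in V ->
  chordal_rows H V r -> chordal_rows (shift i j H) V r.
Proof.
move=> sH good iV jV [vs [uvs vsV pvs rvs]].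
have [||vs' [pvs' pe bb]] := peo_shift sH good uvs _ _ pvs; rewrite ?vsV //.
exists vs'; split=> //; first by rewrite (perm_uniq pvs').
  by move=> x; rewrite (perm_mem pvs') vsV.
by move=> k; rewrite (permP bb) rvs.
Qed.

Lemma chordal_rows_star H V r u : simple_graph H -> u \in V ->
  (forall x y, x \in V -> y \in V -> adj H x y -> x != u -> adj H x u) ->
  chordal_rows H V r ->
  chordal_rows H (V :\ u) (fun k => r k.+1) /\ r 0 = #|[set x in V | adj H u x]|.
Proof.
move=> sH uV st [vs [uvs vsV pvs rvs]].
have uvs' : u \in vs by rewrite vsV.
have stv x y : x \in vs -> y \in vs -> adj H x y -> x != u -> adj H x u.
  by rewrite !vsV; apply: st.
have [vs' [pvs' pe ck c0]] := peo_star sH uvs uvs' pvs stv.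
split; last first.
  rewrite -rvs c0 -size_filter -(card_uniqP _) ?filter_uniq //.
  by apply: eq_card => x; rewrite mem_filter !inE vsV andbC.
have : uniq (u :: vs') by rewrite (perm_uniq pvs').
case/andP=> unvs' uvs'2; exists vs'; split=> //; last by move=> k; rewrite ck rvs.
move=> x; rewrite !inE -vsV -(perm_mem pvs') inE.
by case: eqP => //= ->; rewrite (negbTE unvs').
Qed.

Lemma chordal_rows_gap H V r k : chordal_rows H V r -> (0 < r k.+1)%N -> (r k.+1 < r k)%N.
Proof. by move=> [vs [uvs _ pvs rvs]]; rewrite -!rvs; apply: backdeg_gap. Qed.

Lemma eq_chordal_rows H H' V r r' : {in V &, adj H =2 adj H'} -> r =1 r' ->
  chordal_rows H V r -> chordal_rows H' V r'.
Proof.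
move=> ee rr [vs [uvs vsV pvs rvs]]; exists vs.
have ee' : {in vs &, adj H =2 adj H'} by move=> x y; rewrite !vsV; apply: ee.
split=> //; first exact: eq_peo pvs.
by move=> k; rewrite -(eq_backdeg ee') rvs rr.
Qed.

End PeoShift.

(** * Chordal graphs have perfect elimination orderings *)

Section ShortestPath.
Variables (T : finType) (e : rel T) (A : pred T) (x y : T).

(** The path has minimal length among those through [A]; a chord would cut out the stretch between
    its ends. *)
Lemma shortest_path q0 : path e x q0 -> last x q0 = y -> all A q0 ->
  exists q, [/\ path e x q, last x q = y, all A q, uniq (x :: q)
    & forall i j, i.+1 < j <= size q -> ~~ e (nth x (x :: q) i) (nth x (x :: q) j)].
Proof.
move=> pq0 lq0 Aq0.
pose P m := [exists q : m.-tuple T, [&& path e x q, last x q == y & all A q]].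
have exP : exists m, P m.
  exists (size q0); apply/existsP; exists (in_tuple q0).
  by rewrite pq0 Aq0 lq0 eqxx.
have [m /existsP[q /and3P[pq /eqP lq Aq]] min] := ex_minnP exP.
have {}min q' : path e x q' -> last x q' = y -> all A q' -> (size q <= size q')%N.
  move=> pq' lq' Aq'; rewrite size_tuple; apply: min; apply/existsP.
  by exists (in_tuple q'); rewrite pq' Aq' lq' eqxx.
exists q; split=> //.
  case/shortenP: pq lq min (pq) => q' pq' uq' sq' lq' min pq.
  have Aq' : all A q' by apply/allP=> z /sq'; apply/allP.
  apply: (leq_size_uniq uq'); last by rewrite /= ltnS min.
  by move=> z; rewrite !inE => /orP[->//|/sq' ->]; rewrite orbT.
move=> i j /andP[ij jq]; apply/negP=> eij.
have j1 : (j.-1 < size q)%N by lia.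
(* Positions count the starting point [x], so position [j] of [x :: q] is position [j.-1] of [q]. *)
have dj : drop j.-1 q = nth x q j.-1 :: drop j q.
  by rewrite (drop_nth x) //; congr (_ :: drop _ _); lia.
have zj : nth x (x :: q) j = nth x q j.-1 by case: (j) ij.
have zi : last x (take i q) = nth x (x :: q) i.
  rewrite (last_nth x) size_takel; last by lia.
  by case: (i) ij => //= k kj; rewrite nth_take.
have pd : path e x (take j.-1 q ++ drop j.-1 q) by rewrite cat_take_drop.
have := min (take i q ++ drop j.-1 q); rewrite size_cat size_drop size_takel; last by lia.
suff H : path e x (take i q ++ drop j.-1 q) /\ last x (take i q ++ drop j.-1 q) = y.
  case: H => h1 h2 /(_ h1 h2).
  have A' : all A (take i q ++ drop j.-1 q).
    rewrite all_cat; apply/andP; split; apply/allP=> z.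
      by move/mem_take => zq; move/allP: Aq; apply.
    by move/mem_drop => zq; move/allP: Aq; apply.
  by move=> /(_ A'); lia.
split.
  rewrite cat_path take_path //= dj /= zi -zj eij /=.
  by rewrite zj; move: pd; rewrite cat_path dj /= => /andP[_ /andP[_]].
by move: lq; rewrite -{1}(cat_take_drop j.-1 q) !last_cat dj.
Qed.

End ShortestPath.

Section CycleChordal.
Variables (n : nat) (G : {set {set 'I_n}}).
Hypotheses (simpleG : simple_graph G) (chordalG : chordal G).
Implicit Types (W : {set 'I_n}) (a b x y : 'I_n).
Let e := adj G.
Let e_sym : ssrbool.symmetric e := @adj_sym n G.
Let e_irr : irreflexive e. Proof. by move=> x; apply: adjxx. Qed.

(* [C] plays the role of a component of the non-neighbours of [a], and [x], [y]
   that of two of its boundary vertices. A shortest path through [C] from [x]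
   to [y], closed by [a], has no chord. *)
Lemma boundary_clique (C : pred 'I_n) a x y q0 :
  ~~ C a -> (forall c, C c -> ~~ e a c) -> e a x -> e a y -> x != y ->
  path e x q0 -> last x q0 = y -> all (fun z => C z || (z == y)) q0 -> e x y.
Proof.
move=> Ca aC ax ay xy pq0 lq0 Aq0.
have [q [pq lq Aq uq chq]] := shortest_path pq0 lq0 Aq0.
apply/negPn/negP=> nxy.
have naC z : z \in q -> z != y -> C z.
  by move=> zq zy; move/allP: Aq => /(_ z zq); rewrite (negbTE zy) orbF.
have Cx : ~~ C x by apply: contraL ax => /aC.
have ax' : a != x by apply: contraTneq ax => ->; rewrite e_irr.
have ay' : a != y by apply: contraTneq ay => ->; rewrite e_irr.
have uc : uniq (a :: x :: q).
  rewrite cons_uniq uq andbT inE negb_or ax' /=.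
  by apply: contra Ca => aq; apply: naC.
have cyc : ucycle e (a :: x :: q).
  by rewrite /ucycle uc andbT /= ax /= rcons_path pq lq /= e_sym.
have q2 : (1 < size q)%N.
  case: (q) pq lq => [|z [|z' q']] //= => [_ E|/andP[xz _] E]; first by rewrite E eqxx in xy.
  by rewrite -E xz in nxy.
have [z1 [z2 [z1c z2c e12 n12 n21]]] := chordalG cyc q2; rewrite -/(e z1 z2) in e12.
(* The default [a] of [nth] closes the cycle: past the end of the path comes [a]. *)
have nxt z : z \in x :: q -> next (a :: x :: q) z = nth a (x :: q) (index z (x :: q)).+1.
  move=> zq; have za : a != z.
    by apply: contraTneq zq => <-; case/andP: uc.
  by rewrite next_nth inE zq orbT /= (negbTE za).
have idx z : z \in x :: q -> nth x (x :: q) (index z (x :: q)) = z by apply: nth_index.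
have both u v : u \in x :: q -> v \in x :: q -> e u v -> v != next (a :: x :: q) u ->
    (index u (x :: q) < index v (x :: q))%N -> False.
  move=> uq' vq' euv nuv iuv.
  have iv : (index v (x :: q) <= size q)%N by rewrite -ltnS -[(size q).+1]/(size (x :: q)) index_mem.
  case: (ltngtP (index u (x :: q)).+1 (index v (x :: q))) => [lt|gt|eq].
  - by have := chq _ _ (introT andP (conj lt iv)); rewrite !idx // euv.
  - by move: gt; rewrite ltnNge iuv.
  - by move: nuv; rewrite nxt // eq nth_index // eqxx.
(* As [a] sees nothing in [C] and is followed by [x], a chord at [a] could only lead to [y], which
   is also next to [a] on the cycle. *)
have nxa z : z \in x :: q -> e a z -> z != next (a :: x :: q) a -> a != next (a :: x :: q) z -> False.
  move=> zq az nz na.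
  have zy : z = y.
    apply/eqP/negPn/negP=> zy; move: zq; rewrite inE => /orP[/eqP zx|zq].
      by move: nz; rewrite /= eqxx zx eqxx.
    by move: az; apply/negP; apply: aC; apply: naC.
  move: na; rewrite nxt // zy -lq index_last // nth_default ?eqxx //.
move: z1c z2c; rewrite [z1 \in _]inE [z2 \in _]inE.
case/orP=> [/eqP z1a|z1q]; case/orP=> [/eqP z2a|z2q].
- by move: e12; rewrite z1a z2a e_irr.
- by rewrite z1a in e12 n12 n21; apply: (nxa z2).
- by rewrite z2a e_sym in e12 n12 n21; apply: (nxa z1); rewrite // e_sym.
- case: (ltngtP (index z1 (x :: q)) (index z2 (x :: q))) => [lt|gt|eq].
  + exact: (both z1 z2).
  + by apply: (both z2 z1) => //; rewrite e_sym.
  + by move: e12; rewrite -(idx _ z1q) eq (idx _ z2q) e_irr.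
Qed.

(** Let [C] be the component of [b] among the non-neighbours of [a]; its boundary [S] is a clique by
    [boundary_clique]. The smaller graph on [C :|: S] has a simplicial vertex in [C], since two
    non-adjacent vertices cannot both lie in [S], and all neighbours in [W] of a vertex of [C] lie
    in [C :|: S]. *)
Lemma nonneighbour_simplicial W a b :
  (forall W', (#|W'| < #|W|)%N ->
    {in W' &, forall x y, x != y -> e x y} \/
    exists s t, [/\ s \in W', t \in W', s != t, ~~ e s t
                  & simplicial e s (enum W') /\ simplicial e t (enum W')]) ->
  a \in W -> b \in W -> b != a -> ~~ e a b ->
  exists s, [/\ s \in W, s != a, ~~ e a s & simplicial e s (enum W)].
Proof.
move=> IH aW bW ba nab.
pose U : {set 'I_n} := [set x in W | (x != a) && ~~ e a x].
pose R x y := [&& e x y, x \in U & y \in U].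
have R_sym : ssrbool.symmetric R by move=> x y; rewrite /R e_sym [_ && (y \in U)]andbC.
have bU : b \in U by rewrite inE bW ba nab.
pose C := [set x | connect R b x].
have CU x : x \in C -> x \in U.
  rewrite inE => /connectP[p pp ->]; elim/last_ind: p pp => // p z _.
  by rewrite rcons_path last_rcons => /andP[_ /and3P[]].
have CC x y : x \in C -> y \in U -> e x y -> y \in C.
  move=> xC yU exy; rewrite inE; move: (xC); rewrite inE => /connect_trans; apply.
  by apply: connect1; rewrite /R exy yU CU.
pose S := [set x in W | (x \notin C) && [exists c in C, e x c]].
have Sa x : x \in S -> e a x.
  rewrite inE => /and3P[xW xC /exists_inP[c cC exc]].
  apply/negPn/negP=> nax; case/negP: xC; apply: (CC c) => //; last by rewrite e_sym.
  rewrite inE xW nax andbT; apply: contraTneq exc => ->.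
  by move/CU: cC; rewrite inE => /and3P[].
have clS x y : x \in S -> y \in S -> x != y -> e x y.
  move=> xS yS xy.
  move: (xS) (yS); rewrite !inE => /and3P[_ xC /exists_inP[c cC xc]] /and3P[_ yC /exists_inP[d dC yd]].
  have /connectP[p pp lp] : connect R c d.
    move: cC dC; rewrite !inE => bc bd; apply: connect_trans bd.
    by rewrite (sym_connect_sym R_sym).
  have pC : {subset p <= C}.
    move=> z zp; rewrite inE; move: cC; rewrite inE => /connect_trans; apply.
    by apply: (path_connect pp); rewrite inE zp orbT.
  apply: (@boundary_clique (mem C) a x y (c :: rcons p y)) => //.
  - by apply/negP=> /CU; rewrite inE eqxx andbF.
  - by move=> z /CU; rewrite inE => /and3P[].
  - exact: Sa.
  - exact: Sa.
  - rewrite /= xc rcons_path -lp [e d y]e_sym yd andbT.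
    by apply: sub_path pp => u v /and3P[].
  - by rewrite /= last_rcons.
  - rewrite /= [c \in C]cC /= all_rcons eqxx orbT /=; apply/allP=> z /pC zC.
    by rewrite [z \in C]zC.
have nbC s : s \in C -> simplicial e s (enum (C :|: S)) ->
    exists s, [/\ s \in W, s != a, ~~ e a s & simplicial e s (enum W)].
  move=> sC ss; exists s; move: (CU _ sC); rewrite inE => /and3P[sW sa nas]; split=> //.
  have nb x : x \in W -> e s x -> x \in C :|: S.
    move=> xW sx; rewrite !inE xW /=; case: (boolP (connect R b x)) => //= nC.
    by apply/exists_inP; exists s => //; rewrite e_sym.
  move=> x y; rewrite !mem_enum => xW yW sx sy; apply: ss; rewrite ?mem_enum //; exact: nb.
have lt : (#|C :|: S| < #|W|)%N.
  apply: proper_card; apply/properP; split.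
    by apply/subsetP=> x /setUP[/CU|]; rewrite inE => /and3P[].
  exists a => //; apply/setUP=> -[/CU|/Sa]; last by rewrite e_irr.
  by rewrite inE eqxx andbF.
have bC : b \in C by rewrite inE connect0.
case: (IH _ lt) => [cpl|[s [t [sW tW st nst [ss tt]]]]].
  by apply: (nbC b) => // x y; rewrite !mem_enum => xW yW _ _; apply: cpl.
case: (boolP (s \in C)) => sC; first exact: (nbC s).
case: (boolP (t \in C)) => tC; first exact: (nbC t).
case/setUP: sW => [|sS]; first by rewrite (negbTE sC).
case/setUP: tW => [|tS]; first by rewrite (negbTE tC).
by rewrite clS in nst.
Qed.

(** Applying [nonneighbour_simplicial] to a vertex [a] gives [s]; applying it again to [s] gives a
    simplicial [t] not adjacent to [s]. *)
Lemma chordal_dirac W : {in W &, forall x y, x != y -> e x y} \/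
    exists s t, [/\ s \in W, t \in W, s != t, ~~ e s t
                  & simplicial e s (enum W) /\ simplicial e t (enum W)].
Proof.
have [m] := ubnP #|W|; elim: m W => // m IH W; rewrite ltnS => Wm.
have {}IH := fun W' (lt : (#|W'| < #|W|)%N) => IH W' (leq_trans lt Wm).
case: (boolP [forall x in W, forall y in W, (x != y) ==> e x y]) => [/forall_inP cpl|].
  by left=> x y xW yW xy; move/forall_inP/(_ _ yW)/implyP: (cpl _ xW); apply.
rewrite negb_forall_in => /exists_inP[a aW]; rewrite negb_forall_in => /exists_inP[b bW].
rewrite negb_imply => /andP[ab nab]; right.
have ba : b != a by rewrite eq_sym.
have [s [sW sa nas ss]] := nonneighbour_simplicial IH aW bW ba nab.
have nsa : ~~ e s a by rewrite e_sym.
have as' : a != s by rewrite eq_sym.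
have [t [tW ts nst tt]] := nonneighbour_simplicial IH sW aW as' nsa.
by exists s, t; split=> //; rewrite eq_sym.
Qed.

Lemma chordal_peo W : exists vs, [/\ uniq vs, vs =i W & peo e vs].
Proof.
have [m] := ubnP #|W|; elim: m W => // m IH W; rewrite ltnS => Wm.
case: (set_0Vmem W) => [->|[x xW]]; first by exists [::]; split=> // x; rewrite inE.
have [w [wW sw]] : exists w, w \in W /\ simplicial e w (enum W).
  case: (chordal_dirac W) => [cpl|[s [t [sW _ _ _ [ss _]]]]]; last by exists s.
  by exists x; split=> // y z; rewrite !mem_enum => yW zW _ _; apply: cpl.
have [|vs [uvs vsW pvs]] := IH (W :\ w); first by move: Wm; rewrite (cardsD1 w W) wW.
exists (w :: vs); split=> /=.
- by rewrite vsW !inE eqxx.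
- by move=> y; rewrite inE vsW !inE; case: eqP => // ->.
- split=> //; apply: sub_simplicial sw => y; rewrite vsW mem_enum.
  by move/setD1P=> [].
Qed.

Lemma chordal_has_rows : exists r, chordal_rows G [set: 'I_n] r.
Proof.
have [vs [uvs vsW pvs]] := chordal_peo [set: 'I_n].
by exists (fun k => count (ltn k) (backdeg e vs)); exists vs.
Qed.

End CycleChordal.

(** * Graphs with prescribed rows *)

Section Rows.
Variable n : nat.
Implicit Types (E H G D : {set {set 'I_n}}) (V S : {set 'I_n}) (i j u v w x y : 'I_n).
Implicit Types (vs t : seq 'I_n) (r : nat -> nat).

Lemma eq_set2 (T : finType) (a b c d : T) :
  ([set a; b] == [set c; d]) = (a == c) && (b == d) || (a == d) && (b == c).
Proof.
apply/eqP/orP => [E|[|] /andP[/eqP-> /eqP->]] //; last by rewrite setUC.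
have Ea : a \in [set c; d] by rewrite -E !inE eqxx.
have Eb : b \in [set c; d] by rewrite -E !inE eqxx orbT.
have Ec : c \in [set a; b] by rewrite E !inE eqxx.
have Ed : d \in [set a; b] by rewrite E !inE eqxx orbT.
move: Ea Eb Ec Ed; rewrite !inE => /orP[] /eqP->; rewrite eqxx /=.
  move=> /orP[] /eqP-> _; last by rewrite eqxx; left.
  by rewrite orbb eq_sym => ->; left.
move=> /orP[] /eqP->; rewrite eqxx; first by right.
by rewrite orbb andbT => + _; rewrite eq_sym => ->; left.
Qed.

Lemma simple_graph_eq H H' : simple_graph H -> simple_graph H' ->
  (forall x y, x != y -> adj H x y = adj H' x y) -> H = H'.
Proof.
move=> sH sH' ee; apply/setP=> S.
case S2: (#|S| == 2); last first.
  move/forall_inP: sH => sH; move/forall_inP: sH' => sH'.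
  by apply/idP/idP => [/sH|/sH']; rewrite S2.
by case/cards2P: S2 => x [y [xy ->]]; apply: ee.
Qed.

Definition star_rows u c : {set {set 'I_n}} :=
  [set [set u; v] | v : 'I_n & (u < v <= u + c)%N].

(** The index of [r] starts at the first remaining vertex [k], so deleting that vertex just drops
    [r 0]. A row that would run past the last vertex is cut off by the type. *)
Definition rows_graph k r : {set {set 'I_n}} :=
  [set [set p.1; p.2] | p : 'I_n * 'I_n & (k <= p.1)%N && (p.1 < p.2 <= p.1 + r (p.1 - k))%N].

Definition supported V H := forall S, S \in H -> S \subset V.

Definition from_vertex k : {set 'I_n} := [set x : 'I_n | (k <= x)%N].

Lemma simple_star_rows u c : simple_graph (star_rows u c).
Proof.
apply/forall_inP=> S /imsetP[v]; rewrite inE => /andP[uv _] ->.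
by rewrite cards2 neq_ltn uv.
Qed.

Lemma simple_rows_graph k r : simple_graph (rows_graph k r).
Proof.
apply/forall_inP=> S /imsetP[p]; rewrite inE => /and3P[_ uv _] ->.
by rewrite cards2 neq_ltn uv.
Qed.

Lemma simple_setU H H' : simple_graph H -> simple_graph H' -> simple_graph (H :|: H').
Proof.
move=> /forall_inP sH /forall_inP sH'; apply/forall_inP=> S /setUP[]; [exact: sH|exact: sH'].
Qed.

Lemma adj_setU H H' x y : adj (H :|: H') x y = adj H x y || adj H' x y.
Proof. by rewrite /adj inE. Qed.

Lemma adj_star_rows u c x y : adj (star_rows u c) x y =
  (x == u) && (u < y <= u + c)%N || (y == u) && (u < x <= u + c)%N.
Proof.
apply/imsetP/orP => [[v]|].
  rewrite inE => uv /eqP; rewrite eq_set2 => /orP[]/andP[/eqP-> /eqP->]; rewrite eqxx uv; by [left|right].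
by case=> /andP[/eqP-> uv]; [exists y|exists x]; rewrite ?inE // setUC.
Qed.

Lemma adj_rows_graph k r x y : (x < y)%N ->
  adj (rows_graph k r) x y = (k <= x)%N && (y <= x + r (x - k))%N.
Proof.
move=> xy; apply/imsetP/andP => [[[a b]]|[kx yx]]; last first.
  by exists (x, y); rewrite // inE /= kx xy yx.
rewrite inE /= => /and3P[ka ab ba] /eqP; rewrite eq_set2 => /orP[]/andP[/eqP ea /eqP eb].
  by rewrite ea eb.
by move: xy; rewrite ea eb ltnNge ltnW.
Qed.

Lemma supported_adj V H x y : supported V H -> adj H x y -> (x \in V) && (y \in V).
Proof. by move=> sV /sV; rewrite subUset !sub1set. Qed.

Lemma supported_shift V H i j : i \in V -> supported V H -> supported V (shift i j H).
Proof.
move=> iV sV _ /imsetP[S /sV SV ->]; rewrite /shift_face; case: ifP => // _.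
by rewrite subUset sub1set iV (subset_trans (subD1set _ _)).
Qed.

Lemma rows_graph_rec u r :
  rows_graph u r = star_rows u (r 0) :|: rows_graph u.+1 (fun k => r k.+1).
Proof.
apply: simple_graph_eq; rewrite ?simple_setU ?simple_rows_graph ?simple_star_rows //.
move=> x y; wlog xy : x y / (x < y)%N => [W|_].
  rewrite neq_ltn => /orP[] lt; first by rewrite W // neq_ltn lt.
  by rewrite adj_sym [RHS]adj_sym W // neq_ltn lt.
rewrite adj_setU adj_star_rows !adj_rows_graph //.
rewrite -!val_eqE /=; case: (ltngtP x u) => [lt|gt|eqx] /=.
- by rewrite andbF.
- have -> : (x - u)%N = (x - u.+1).+1 by lia.
  by rewrite (gtn_eqF (ltn_trans gt xy)).
- by rewrite eqx subnn -eqx xy andbF !orbF.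
Qed.

Lemma rows_graph0 k r : (forall k, r k = 0) -> rows_graph k r = set0.
Proof.
move=> r0; apply/setP=> S; rewrite !inE; apply/imsetP=> -[p].
by rewrite inE r0 addn0 => /and3P[_ lt le]; move: lt; rewrite ltnNge le.
Qed.

Lemma chordal_rows0 V r : chordal_rows set0 V r -> forall k, r k = 0.
Proof.
move=> [vs [_ _ _ rvs]] k; rewrite -rvs; elim: vs {rvs} => //= v t ->.
by rewrite addn0 (eq_count (a2 := pred0)) ?count_pred0 // => x; rewrite /= /adj inE.
Qed.

(** The neighbours of [u] in the star form an interval starting right after [u], so an edge from [u]
    to [j] never moves: its target is already present. Later rows can thus be straightened without
    disturbing finished ones. *)
Lemma shift_star_union u c i j H : (u < i)%N -> (i < j)%N -> simple_graph H ->
  supported (from_vertex u.+1) H ->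
  shift i j (star_rows u c :|: H) = star_rows u c :|: shift i j H.
Proof.
move=> ui ij sH suH; have ijn : i != j by rewrite neq_ltn ij.
have uH x : adj H x u = false.
  by apply/negP=> /(supported_adj suH)/andP[_]; rewrite inE ltnn.
have sS := simple_star_rows u c.
have iu : (i == u) = false by rewrite -val_eqE gtn_eqF.
have ju : (j == u) = false by rewrite -val_eqE gtn_eqF // (ltn_trans ui).
have sA := simple_setU sS sH.
have key x y : x != y -> x != j -> y != j -> y != i ->
    adj (shift i j (star_rows u c :|: H)) x y = adj (star_rows u c :|: shift i j H) x y.
  move=> xy xj yj yi; rewrite [RHS]adj_setU; case: (eqVneq x i) => [->|xi].
    rewrite !adj_shift_l // !adj_setU !adj_star_rows iu ju /=.
    by case: (eqVneq y u) => [->|] //=; rewrite !uH !orbF; lia.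
  by rewrite !adj_shift_other // adj_setU.
have keyj y : y != i -> y != j ->
    adj (shift i j (star_rows u c :|: H)) j y = adj (star_rows u c :|: shift i j H) j y.
  move=> yi yj; rewrite [RHS]adj_setU !adj_shift_r // !adj_setU !adj_star_rows iu ju /=.
  case: (eqVneq y u) => [->|] //=; rewrite !uH !orbF; lia.
have keyij : adj (shift i j (star_rows u c :|: H)) i j = adj (star_rows u c :|: shift i j H) i j.
  by rewrite [RHS]adj_setU !adj_shift_ij adj_setU.
apply: simple_graph_eq; [exact: simple_shift|exact/simple_setU/simple_shift|].
move=> x y xy; case: (eqVneq y j) => [yj|yj].
  rewrite yj in xy *; case: (eqVneq x i) => [->//|xi].
  by rewrite adj_sym [RHS]adj_sym keyj.
case: (eqVneq x j) => [xj|xj].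
  rewrite xj in xy *; case: (eqVneq y i) => [->|yi]; last exact: keyj.
  by rewrite adj_sym [RHS]adj_sym.
case: (eqVneq y i) => [yi|yi]; last exact: key.
by rewrite adj_sym [RHS]adj_sym key // ?yi //; rewrite -?yi // eq_sym.
Qed.

Definition shifts (s : seq ('I_n * 'I_n)) H := foldl (fun H p => shift p.1 p.2 H) H s.

Lemma shifts_star_union u c s H : simple_graph H ->
  supported (from_vertex u.+1) H ->
  all (fun p : 'I_n * 'I_n => (u < p.1 < p.2)%N) s ->
  shifts s (star_rows u c :|: H) = star_rows u c :|: shifts s H.
Proof.
elim: s H => //= p s IH H sH suH /andP[/andP[up pp] als].
rewrite shift_star_union // IH //; first exact: simple_shift.
by apply: supported_shift; rewrite // inE.
Qed.

(** Termination measure: a shift that moves an edge trades a label [j] for a smaller [i]. *)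
Definition weight H := \sum_(S in H) \sum_(x in S) (x : nat).

Lemma weight_shift_face i j H S : (i < j)%N ->
  (\sum_(x in shift_face i j H S) (x : nat) + (shift_face i j H S != S) <= \sum_(x in S) (x : nat))%N.
Proof.
move=> ij; rewrite /shift_face; case: ifP => [/and3P[jS iS _]|]; last by rewrite eqxx addn0.
rewrite big_setU1 ?inE ?(negbTE iS) ?andbF //= (big_setD1 j jS) /=.
by apply: leq_trans (leq_add (leqnn _) (leq_b1 _)) _; rewrite addn1 -addSn leq_add2r.
Qed.

Lemma weight_shift i j H : (i < j)%N -> shift i j H != H -> (weight (shift i j H) < weight H)%N.
Proof.
move=> ij ne.
have /exists_inP[S SH nS] : [exists S in H, shift_face i j H S != S].
  apply: contraNT ne; rewrite negb_exists_in => /forall_inP all_id.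
  rewrite /shift; apply/eqP; rewrite -[RHS]imset_id; apply: eq_in_imset => S SH.
  by move: (all_id S SH); rewrite negbK => /eqP.
rewrite /weight big_imset /=; last exact: shift_face_inj.
rewrite (bigD1 S) //= [X in (_ < X)%N](bigD1 S) //= -addSn; apply: leq_add.
  by have := weight_shift_face H S ij; rewrite nS addn1.
apply: leq_sum => T _; apply: leq_trans (weight_shift_face H T ij); exact: leq_addr.
Qed.

Lemma card_interval a b : (b <= n)%N -> #|[set x : 'I_n | (a <= x < b)%N]| = (b - a)%N.
Proof.
move=> bn; rewrite -sum1dep_card -[RHS]muln1 -sum_nat_const_nat.
rewrite big_geq_mkord (big_ord_widen_cond _ (fun i : nat => (a <= i)%N) (fun=> 1%N) bn).
by apply: eq_bigl => x.
Qed.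

Lemma down_closed_interval (A : {set 'I_n}) u :
  (forall x, x \in A -> (u < x)%N) ->
  (forall x y, x \in A -> (u < y < x)%N -> y \in A) ->
  forall x, (x \in A) = (u < x <= u + #|A|)%N.
Proof.
move=> Au Ad x; apply/idP/andP => [xA|[ux xA]].
  split; first exact: Au.
  have : ([set y : 'I_n | u.+1 <= y < x.+1]%N \subset A).
    apply/subsetP=> y; rewrite inE ltnS => /andP[uy]; rewrite leq_eqVlt => /orP[/eqP/val_inj->//|yx].
    by apply: (Ad x); rewrite ?uy.
  by move/subset_leq_card; rewrite card_interval // subSS leq_subLR.
apply/negPn/negP=> nx.
have : A \subset [set y : 'I_n | u.+1 <= y < x]%N.
  apply/subsetP=> y yA; rewrite inE (Au _ yA) /= ltnNge; apply: contra nx.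
  rewrite leq_eqVlt => /orP[/eqP/val_inj->//|xy]; apply: (Ad y) => //.
  by rewrite ux.
move/subset_leq_card; rewrite card_interval ?(ltnW (ltn_ord x)) // => cA.
by move: ux xA cA; move: #|A| => c; lia.
Qed.

(** Admissible shifts are applied until none changes the graph; each property of the result comes
    from one particular shift that fixes it. *)
Lemma reduce_to_star u H r : simple_graph H -> supported (from_vertex u) H ->
  chordal_rows H (from_vertex u) r ->
  exists s, [/\ all (fun p : 'I_n * 'I_n => (u <= p.1)%N && (p.1 < p.2)%N) s,
    chordal_rows (shifts s H) (from_vertex u) r,
    forall x, adj (shifts s H) u x = (u < x <= u + r 0)%N
    & forall x y, adj (shifts s H) x y -> x != u -> adj (shifts s H) x u].
Proof.
have [m] := ubnP (weight H); elim: m H => // m IH H; rewrite ltnS => Hm sH suH crH.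
pose good i j := edge_shift H i j || (disjoint_shift H i j && (i != j)).
case: (boolP [exists p : 'I_n * 'I_n, [&& (u <= p.1)%N, (p.1 < p.2)%N, good p.1 p.2 & shift p.1 p.2 H != H]]).
  case/existsP=> -[i j] /= /and4P[ui ij gij ne].
  have iV : i \in from_vertex u by rewrite inE.
  have jV : j \in from_vertex u by rewrite inE; lia.
  have [||||s [als crs st1 st2]] := IH (shift i j H).
  - exact: leq_trans (weight_shift ij ne) Hm.
  - exact: simple_shift.
  - exact: supported_shift.
  - exact: chordal_rows_shift.
  by exists ((i, j) :: s); split=> //=; rewrite ui ij.
move=> none; exists [::]; rewrite /shifts /=.
have {none} id_shift i j : (u <= i)%N -> (i < j)%N -> good i j -> shift i j H = H.
  move=> ui ij gij; apply/eqP/negPn/negP=> ne; case/existsP: none.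
  by exists (i, j); rewrite /= ui ij gij ne.
have ge x y : adj H x y -> (u <= x)%N.
  by move/(supported_adj suH)/andP=> []; rewrite inE.
have irr := fun x => adjxx x sH.
(* A non-isolated [x] not reachable from [u] would allow a disjoint shift, which hands the
   neighbours of [x] to [u]; as the graph is fixed, [u] already has them, and [x] is reachable after
   all. *)
have conn x y : adj H x y -> connect (adj H) u x.
  move=> xy; case: (eqVneq u x) => [->|ux]; first exact: connect0.
  apply/negPn/negP=> nc; have lt : (u < x)%N.
    by rewrite ltn_neqAle (ge _ _ xy) andbT.
  have g : good u x by rewrite /good /disjoint_shift nc ux orbT.
  have uy : y != u.
    by apply: contraNneq nc => <-; apply: connect1; rewrite adj_sym.
  have := adj_shift_l H ux uy; rewrite id_shift // xy orbT => /(_ _)/esym.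
  have yx : y != x by apply: contraTneq xy => ->; rewrite irr.
  move=> /(_ yx)/esym uy'; case/negP: nc; apply: connect_trans (connect1 uy') _.
  by apply: connect1; rewrite adj_sym.
(* The edge shift along [u v] hands the neighbours of [v] to [u]. *)
have edge v x : adj H u v -> adj H v x -> x != u -> adj H u x.
  move=> uv vx xu; have uvn := adj_neq sH uv.
  have xv : x != v by rewrite eq_sym (adj_neq sH vx).
  have lt : (u < v)%N by rewrite ltn_neqAle uvn (ge v x).
  have g : good u v by rewrite /good /edge_shift uv.
  by have := adj_shift_l H uvn xu xv; rewrite id_shift // vx orbT.
have star x y : adj H x y -> x != u -> adj H x u.
  move=> xy xu; have /connectP[p pp lp] := conn _ _ xy.
  have cl : forall p z, (z == u) || adj H u z -> path (adj H) z p -> (last z p == u) || adj H u (last z p).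
    elim=> //= z p' IHp a zu /andP[az pz]; apply: IHp pz; case: eqP => //= /eqP zu'.
    by case/orP: zu => [/eqP <-//|ua]; apply: edge az _.
  have := cl p u; rewrite eqxx -lp (negbTE xu) => /(_ isT pp) /=.
  by rewrite adj_sym.
have [_ r0] : chordal_rows H (from_vertex u :\ u) (fun k => r k.+1) /\ r 0 = #|[set x in from_vertex u | adj H u x]|.
  by apply: chordal_rows_star => //; [rewrite inE | move=> x y _ _; apply: star].
split=> // x; rewrite r0 -down_closed_interval.
- rewrite !inE; case ux: (adj H u x); rewrite ?andbF // andbT; apply/esym.
  by apply: (ge x u); rewrite adj_sym.
- move=> {}x; rewrite inE => /andP[]; rewrite inE => xu ux.
  by rewrite ltn_neqAle xu andbT (adj_neq sH ux).
(* A vertex [y] skipped below a neighbour [x] of [u] is isolated, since [u] is a star vertex; the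
   disjoint shift from [x] to [y] would then move the edge [u x] to [u y]. Such shifts realise the
   interval that phase III merely records. *)
- move=> {}x y; rewrite !inE => /andP[_ ux] /andP[uy yx]; rewrite (ltnW uy) /=.
  apply/negPn/negP=> nuy.
  have yu : y != u by rewrite neq_ltn uy orbT.
  have xu : u != x by rewrite (adj_neq sH).
  have iso z : adj H y z = false.
    by apply/negP=> yz; case/negP: nuy; rewrite adj_sym; apply: star yz yu.
  have xy : y != x by rewrite neq_ltn yx.
  have g : good y x.
    rewrite /good /disjoint_shift xy andbT; apply/orP; right; apply/connectP=> -[[|z p] /=].
      by move=> _ e; rewrite e eqxx in xy.
    by rewrite iso.
  have uy' : u != y by rewrite eq_sym.
  have := adj_shift_l H xy uy' xu; rewrite id_shift ?(ltnW uy) //.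
  by rewrite (adj_sym _ x u) ux orbT iso.
Qed.

End Rows.

(** * Reaching the rows graph by shifts *)

Section ToRows.
Variable n : nat.
Implicit Types (E H G D : {set {set 'I_n}}) (V S : {set 'I_n}) (i j u v w x y : 'I_n).
Implicit Types (vs t : seq 'I_n) (r : nat -> nat).

Lemma simple_shifts s H : simple_graph H -> simple_graph (shifts s H).
Proof. by elim: s H => //= p s IH H sH; apply: IH; apply: simple_shift. Qed.

Lemma supported_shifts V s H : all (fun p : 'I_n * 'I_n => p.1 \in V) s ->
  supported V H -> supported V (shifts s H).
Proof.
by elim: s H => //= p s IH H /andP[pV sV] suH; apply: IH => //; apply: supported_shift.
Qed.

Lemma card_shifts s H : #|shifts s H| = #|H|.
Proof. by elim: s H => //= p s IH H; rewrite IH card_shift. Qed.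

Lemma from_vertexD1 u : from_vertex n u :\ u = from_vertex n u.+1.
Proof. by apply/setP=> x; rewrite !inE ltn_neqAle eq_sym. Qed.

Definition induced V H := [set S in H | S \subset V].

Lemma adj_induced V H x y : adj (induced V H) x y = [&& adj H x y, x \in V & y \in V].
Proof. by rewrite /adj inE subUset !sub1set. Qed.

Lemma simple_induced V H : simple_graph H -> simple_graph (induced V H).
Proof. by move=> /forall_inP sH; apply/forall_inP=> S; rewrite inE => /andP[/sH]. Qed.

Lemma supported_induced V H : supported V (induced V H).
Proof. by move=> S; rewrite inE => /andP[]. Qed.

Lemma chordal_rows_induced V H r : chordal_rows H V r -> chordal_rows (induced V H) V r.
Proof.
by apply: eq_chordal_rows => // x y xV yV; rewrite adj_induced xV yV !andbT.
Qed.

(** After [reduce_to_star] the graph is a finished star at [u] together with a graph on the later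
    vertices; by [shifts_star_union] the shifts of the recursive call may be carried out in the
    presence of that star. *)
Lemma to_rows k H r : simple_graph H -> supported (from_vertex n k) H ->
  chordal_rows H (from_vertex n k) r ->
  exists s, all (fun p : 'I_n * 'I_n => (k <= p.1)%N && (p.1 < p.2)%N) s /\
            shifts s H = rows_graph n k r.
Proof.
have [m] := ubnP (n - k); elim: m k H r => // m IH k H r; rewrite ltnS => nk sH suH crH.
case: (ltnP k n) => kn; last first.
  exists [::]; split=> //=; apply: simple_graph_eq => //; first exact: simple_rows_graph.
  move=> x y _; apply/idP/idP.
    by case/(supported_adj suH)/andP; rewrite inE leqNgt (leq_trans (ltn_ord x) kn).
  case/imsetP=> p; rewrite inE => /and3P[kp _ _] _.
  by move: kp; rewrite leqNgt (leq_trans (ltn_ord _) kn).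
pose u := Ordinal kn.
have [s1 [als cr1 st1 st2]] := @reduce_to_star n u H r sH suH crH.
have sH1 := simple_shifts s1 sH.
have suH1 : supported (from_vertex n u) (shifts s1 H).
  apply: supported_shifts => //; apply: sub_all als => p /andP[up _]; by rewrite inE.
set H1 := shifts s1 H in cr1 st1 st2 sH1 suH1.
pose H2 := induced (from_vertex n u.+1) H1.
have ge x y : adj H1 x y -> (u <= x)%N.
  by move/(supported_adj suH1)/andP=> []; rewrite inE.
have eH1 : H1 = star_rows u (r 0) :|: H2.
  apply: simple_graph_eq; rewrite ?simple_setU ?simple_star_rows ?simple_induced //.
  move=> x y xy; rewrite adj_setU adj_star_rows adj_induced !inE -!st1.
  case: (eqVneq x u) => [ex|xu] /=.
    by rewrite ex ltnn /= andbF orbF adjxx // andbF orbF.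
  case: (eqVneq y u) => [ey|yu] /=.
    by rewrite ey ltnn /= !andbF orbF adj_sym.
  case xy1: (adj H1 x y) => //=; apply/esym.
  rewrite !ltn_neqAle -!(inj_eq val_inj) /= in xu yu *.
  by rewrite ![_ == val u]eq_sym in xu yu; rewrite xu yu (ge _ _ xy1) (ge y x) // adj_sym.
have [cr2 _] : chordal_rows H1 (from_vertex n u :\ u) (fun k => r k.+1) /\ r 0 = #|[set x in from_vertex n u | adj H1 u x]|.
  by apply: chordal_rows_star => //; [rewrite inE | move=> x y _ _; apply: st2].
rewrite from_vertexD1 in cr2.
have [||||s2 [als2 es2]] := IH k.+1 H2 (fun k => r k.+1).
- by apply: leq_trans nk; rewrite ltn_sub2l.
- exact: simple_induced.
- exact: supported_induced.
- exact: chordal_rows_induced.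
exists (s1 ++ s2); split.
  rewrite all_cat als; apply: sub_all als2 => p /andP[up ->]; by rewrite ltnW.
rewrite /shifts foldl_cat -/(shifts s1 H) -/H1 eH1 -/(shifts _ _) shifts_star_union //.
- by rewrite es2 -[k]/(val u) rows_graph_rec.
- exact: simple_induced.
- exact: supported_induced.
Qed.

Lemma shifted_rows r : (forall k, (0 < r k.+1)%N -> (r k.+1 < r k)%N) ->
  shifted (rows_graph n 0 r).
Proof.
move=> gap i j i' j'.
(* By [gap], the right end [b + r b] of a non-empty row is at most the right end of every earlier
   row. *)
have mono (a b y : nat) : (a <= b)%N -> (b < y)%N -> (y <= b + r b)%N -> (y <= a + r a)%N.
  elim: b => [|b IH]; first by rewrite leqn0 => /eqP->.
  rewrite leq_eqVlt => /orP[/eqP-> //|ab] by_ yb; apply: IH => //; first exact: ltnW.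
  by have := gap b; move: by_ yb; case: (r b.+1) => [|c] h1 h2; [lia | move=> /(_ isT); lia].
have main (a b a' b' : 'I_n) : (a < b)%N -> [set a; b] \in rows_graph n 0 r ->
    (a' < b')%N -> (a' <= a)%N -> (b' <= b)%N -> [set a'; b'] \in rows_graph n 0 r.
  move=> ab; rewrite -!/(adj _ _ _) => + ab'; rewrite !adj_rows_graph // !subn0 /= => ba aa bb.
  by apply: leq_trans bb _; apply: mono aa ab ba.
move=> ij ii jj ne.
have ijn : i != j by exact: (@adj_neq n _ _ _ (simple_rows_graph n 0 r) ij).
move: ne ijn; rewrite !neq_ltn => /orP[] lt' /orP[] lt.
- exact: main lt ij lt' ii jj.
- rewrite setUC in ij.
  exact: main lt ij lt' (leq_trans (ltnW lt') jj) (leq_trans jj (ltnW lt)).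
- rewrite setUC.
  exact: main lt ij lt' (leq_trans (ltnW lt') ii) (leq_trans ii (ltnW lt)).
- by rewrite setUC; rewrite setUC in ij; apply: main lt ij lt' jj ii.
Qed.

End ToRows.

(** * Invariant of the algorithm *)

Lemma repeat_until_ind_inv (T : Type) (step : T -> T -> Prop) (stop : pred T) (P : T -> Prop) x y :
  (forall a b, P a -> step a b -> P b) -> P x -> repeat_until step stop x y -> P y /\ stop y.
Proof.
move=> Pstep Px rep; elim: rep Px => {x y} [x y xy sy Px|x y z xy _ _ IH Px].
  by split=> //; apply: Pstep xy.
by apply: IH; apply: Pstep xy.
Qed.

Section Algorithm.
Variable n : nat.
Implicit Types (E H G D : {set {set 'I_n}}) (V S : {set 'I_n}) (i j u v w x y : 'I_n).
Implicit Types (r : nat -> nat).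

Definition good_graph V r H := [/\ simple_graph H, supported V H & chordal_rows H V r].

Lemma deg_gt0P H x : reflect (exists y, adj H x y) (0 < deg H x)%N.
Proof.
by rewrite /deg card_gt0; apply: (iffP (set0Pn _)) => -[y]; rewrite ?inE => xy; exists y; rewrite ?inE.
Qed.

Lemma good_shift V r H i j : i \in V -> j \in V ->
  edge_shift H i j || (disjoint_shift H i j && (i != j)) ->
  good_graph V r H -> good_graph V r (shift i j H).
Proof.
move=> iV jV g [sH suH crH]; split; first exact: simple_shift.
  exact: supported_shift.
exact: chordal_rows_shift.
Qed.

Lemma phaseI_good V r u H H' : u \in V -> good_graph V r H -> H != set0 ->
  phaseI V u H H' -> good_graph V r H' /\ nb_comp H' == 1.
Proof.
move=> uV gH H0; rewrite /phaseI; case: ifP => [_|ncomp ->].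
  apply: repeat_until_ind_inv gH => a b ga [j [jV _ dj ->]].
  apply: good_shift => //; rewrite dj andTb; apply/orP; right.
  by apply: contraNneq dj => ->; apply: connect0.
split=> //; rewrite eqn_leq leqNgt ncomp /= card_gt0; apply/set0Pn.
case/set0Pn: H0 => S SH; case: gH => /forall_inP sH _ _.
case/cards2P: (sH S SH) => x [y [xy eS]].
exists [set z | connect (adj H) x z]; apply/imsetP; exists x => //.
by rewrite inE; apply/deg_gt0P; exists y; rewrite /adj -eS.
Qed.

Lemma phaseII_good V r u H H' : u \in V -> good_graph V r H -> nb_comp H == 1 ->
  phaseII V u H H' -> good_graph V r H' /\ star_vertex H' u.
Proof.
move=> uV gH c1; rewrite /phaseII c1 /=; case: ifP => [_|/negbFE st -> //].
apply: repeat_until_ind_inv gH => a b ga [j [jV ej ->]].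
by apply: good_shift => //; rewrite ej.
Qed.

(** The expected answer [D0] is the loop constant: the edges already output plus the rows that the
    remaining graph still owes. *)
Definition round_inv D0 (s : state n) : Prop :=
  exists m r, [/\ st_V s = from_vertex n m, good_graph (st_V s) r (st_H s)
    & st_D s :|: rows_graph n m r = D0].

Lemma deg_set0 u : deg (set0 : {set {set 'I_n}}) u = 0.
Proof. by apply: eq_card0 => x; rewrite !inE /adj inE. Qed.

Lemma nb_comp_set0 : nb_comp (set0 : {set {set 'I_n}}) = 0.
Proof.
rewrite /nb_comp; apply/eqP; rewrite cards_eq0; apply/eqP/setP=> A; rewrite inE.
by apply/imsetP=> -[x]; rewrite inE deg_set0.
Qed.

(* The third phase keeps the star around [u] found by the first two, so the
   counts of back-degrees are those of the input shifted by one. *)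
Lemma alg_round_inv D0 (s s' : state n) :
  round_inv D0 s -> alg_round s s' -> round_inv D0 s'.
Proof.
case: s => D V H [m [r [/= eV gH eD]]] [u [H1 [H2 [/= [uV minu] p1 p2 ->]]]].
(* The loop body runs at least once, so it may meet an edgeless graph; the round then changes
   nothing. *)
case: (eqVneq H set0) => [H0|H0].
  move: p1 p2; rewrite H0 /phaseI nb_comp_set0 /= => ->.
  rewrite /phaseII nb_comp_set0 /= => ->; rewrite nb_comp_set0 /=.
  by exists m, r; split=> //=; rewrite -H0.
have [g1 c1] := phaseI_good uV gH H0 p1.
have [g2 st2] := phaseII_good uV g1 c1 p2.
have eu : m = u.
  move: uV; rewrite eV inE => mu; apply/eqP; rewrite eqn_leq mu /=.
  have mn : (m < n)%N := leq_ltn_trans mu (ltn_ord u).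
  by have := minu (Ordinal mn); rewrite eV inE leqnn; apply.
(* That phase II keeps a single component is not claimed: otherwise phase III leaves the state
   alone, and the invariant survives with the same [m] and [r]. *)
case: (boolP (nb_comp H2 == 1)) => [c2|nc2]; last first.
  by exists m, r.
rewrite st2 /=; exists m.+1, (fun k => r k.+1).
case: g2 => sH2 suH2 cr2.
have star x y : adj H2 x y -> x != u -> adj H2 x u.
  move=> xy xu; move/forallP/(_ x): st2; rewrite xu /= => /implyP; apply.
  by apply/deg_gt0P; exists y.
have [cr3 r0] : chordal_rows H2 (V :\ u) (fun k => r k.+1) /\ r 0 = #|[set x in V | adj H2 u x]|.
  by apply: chordal_rows_star => // x y _ _; apply: star.
have eV' : V :\ u = from_vertex n m.+1 by rewrite eV eu from_vertexD1.
split=> //=.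
- split; [exact: simple_induced | exact: supported_induced | exact: chordal_rows_induced].
- rewrite -eD eu rows_graph_rec -setUA; congr (_ :|: (_ :|: _)).
  suff -> : deg H2 u = r 0 by [].
  rewrite r0; apply: eq_card => x; rewrite !inE.
  by case ux: (adj H2 u x); rewrite ?andbF // andbT; case/andP: (supported_adj suH2 ux).
Qed.

Lemma alg_returns_rows G D r : simple_graph G -> chordal_rows G setT r ->
  alg_returns G D -> D = rows_graph n 0 r.
Proof.
move=> sG crG [s rep ->].
have inv0 : round_inv (rows_graph n 0 r) (State set0 setT G).
  exists 0, r; split=> /=; last by rewrite set0U.
    by apply/setP=> x; rewrite !inE.
  by split=> // S _; apply: subsetT.
have [[m [r' [_ [_ _ cr'] <-]]] /eqP H0] :=
  repeat_until_ind_inv (@alg_round_inv _) inv0 rep.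
by rewrite H0 in cr'; rewrite rows_graph0 ?setU0 //; apply: chordal_rows0 cr'.
Qed.

Lemma alg_returns_chordal G D : simple_graph G -> chordal G -> alg_returns G D ->
  exists r s, [/\ chordal_rows G setT r, D = rows_graph n 0 r,
    all (fun p : 'I_n * 'I_n => p.1 < p.2)%N s, D = shifts s G & shifted D].
Proof.
move=> sG chG ret; have [r cr] := chordal_has_rows sG chG.
have eD := alg_returns_rows sG cr ret.
have eT : from_vertex n 0 = setT by apply/setP=> x; rewrite !inE.
have suT : supported (from_vertex n 0) G by rewrite eT => S _; apply: subsetT.
have crT : chordal_rows G (from_vertex n 0) r by rewrite eT.
have [s [als es]] := to_rows sG suT crT.
exists r, s; rewrite es; split=> //; rewrite eD.
by apply: shifted_rows => k; apply: chordal_rows_gap cr.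
Qed.

End Algorithm.

Import GRing.Theory.
Local Open Scope ring_scope.

(** * Minors and their behaviour under shifts *)

Section Pairs.
Variable n : nat.
Implicit Types (H : {set {set 'I_n}}) (x y : 'I_n).

Definition pairs H : {set 'I_n * 'I_n} :=
  [set p : 'I_n * 'I_n | (p.1 < p.2)%N && adj H p.1 p.2].

Lemma card_pairs H : simple_graph H -> #|pairs H| = #|H|.
Proof.
move=> sH; pose f (p : 'I_n * 'I_n) := [set p.1; p.2].
have eH : H = f @: pairs H.
  apply/setP=> S; apply/idP/imsetP => [SH|[p]]; last by rewrite inE => /andP[_ pH] ->.
  have /cards2P[x [y [xy eS]]] := forall_inP sH S SH.
  wlog lt : x y xy eS / (x < y)%N => [W|].
    move: (xy); rewrite neq_ltn => /orP[lt|lt]; first exact: (W x y).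
    by apply: (W y x) => //; [rewrite eq_sym | rewrite setUC].
  by exists (x, y); rewrite // inE /= lt /adj -eS.
transitivity #|f @: pairs H|; last by rewrite -eH.
rewrite card_in_imset // => -[a b] [c d]; rewrite !inE /f /= => /andP[ab _] /andP[cd _] /eqP.
rewrite eq_set2 => /orP[]/andP[/eqP ea /eqP eb]; first by rewrite ea eb.
by move: ab cd; rewrite ea eb; lia.
Qed.

Variables (K : fieldType) (m : nat).
Implicit Types (F : 'I_n -> 'I_n -> 'rV[K]_m).

Definition edge_mx H F : 'M[K]_(#|pairs H|, m) :=
  \matrix_(k < #|pairs H|) F (enum_val k).1 (enum_val k).2.

Lemma edge_mx_sub H F (p : nat) (A : 'M_(p, m)) :
  (forall x y, (x < y)%N -> adj H x y -> (F x y <= A)%MS) -> (edge_mx H F <= A)%MS.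
Proof.
move=> FA; apply/row_subP=> k; rewrite rowK.
by have := enum_valP k; rewrite inE => /andP[]; apply: FA.
Qed.

Lemma sub_edge_mx H F x y : simple_graph H -> (F y x = - F x y) -> adj H x y ->
  (F x y <= edge_mx H F)%MS.
Proof.
move=> sH Fxy xy; have := adj_neq sH xy.
wlog lt : x y xy Fxy / (x < y)%N => [W|_].
  rewrite neq_ltn => /orP[lt|lt]; first by apply: W => //; rewrite neq_ltn lt.
  rewrite -[F x y]opprK -Fxy eqmx_opp; apply: W => //; first by rewrite adj_sym.
    by rewrite Fxy opprK.
  by rewrite neq_ltn lt.
have xyH : (x, y) \in pairs H by rewrite inE /= lt.
have -> : F x y = row (enum_rank_in xyH (x, y)) (edge_mx H F).
  by rewrite rowK enum_rankK_in.
exact: row_sub.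
Qed.

End Pairs.

Section Perturb.
Variable K : fieldType.
Hypothesis charK0 : [pchar K] =i pred0.

Lemma natr_inj_pchar0 : injective (fun i : nat => i%:R : K).
Proof.
move=> i j; wlog ij : i j / (i <= j)%N => [W|].
  by case/orP: (leq_total i j) => [/W//|/W h /esym/h].
move/pcharf0P: charK0 => c0 /eqP; rewrite eq_sym -subr_eq0 -natrB // c0 subn_eq0 => ji.
by apply/eqP; rewrite eqn_leq ij.
Qed.

Lemma exists_nonroot (p : {poly K}) : p != 0 -> exists s, p.[s] != 0.
Proof.
move=> p0; pose rs := [seq i%:R : K | i <- iota 0 (size p)].
case: (boolP (all (root p) rs)) => [ar|/allPn[s _ ns]]; last by exists s.
have := max_poly_roots p0 ar; rewrite map_inj_uniq ?iota_uniq; last exact: natr_inj_pchar0.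
by rewrite size_map size_iota ltnn => /(_ isT).
Qed.

Lemma horner_det_pencil (m : nat) (A B : 'M[K]_m) s :
  (\det (map_mx polyC A + 'X *: map_mx polyC B)).[s] = \det (A + s *: B).
Proof.
rewrite -[_.[s]]/(horner_eval s _) -det_map_mx; congr (\det _).
by apply/matrixP=> i j; rewrite !mxE /= /horner_eval hornerD hornerM hornerX !hornerC.
Qed.

(** A left inverse of [A] makes the pencil square, with determinant 1 at 0. The extra factor ['X]
    forces the non-root [s] to be non-zero. *)
Lemma row_full_perturb (r m : nat) (A B : 'M[K]_(r, m)) :
  row_full A -> exists2 s, s != 0 & row_full (A + s *: B)%R.
Proof.
case/row_fullP=> C CA.
pose P : 'M[{poly K}]_m := map_mx polyC (C *m A) + 'X *: map_mx polyC (C *m B).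
have evP s : (\det P).[s] = \det (C *m (A + s *: B)).
  by rewrite horner_det_pencil mulmxDr -scalemxAr.
have P0 : 'X * \det P != 0.
  rewrite mulf_neq0 ?polyX_eq0 //; apply: contraTneq (oner_neq0 K) => P0.
  by rewrite negbK eq_sym -(horner0 0) -P0 evP scale0r addr0 CA det1.
have [s] := exists_nonroot P0; rewrite hornerM hornerX mulf_eq0 negb_or evP.
case/andP=> s0 ds; exists s => //; apply/row_fullP.
exists (invmx (C *m (A + s *: B)) *m C); rewrite -mulmxA mulVmx //.
by rewrite unitmxE unitfE.
Qed.

End Perturb.

Section Minors.
Variables (K : fieldType) (n : nat).
Hypothesis charK0 : [pchar K] =i pred0.
Implicit Types (H D : {set {set 'I_n}}) (C : {set 'I_n * 'I_n}) (x y i j p q : 'I_n).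
Implicit Types (b : 'M[K]_n).

Definition minor2 b x y p q : K := b x p * b y q - b x q * b y p.

Definition minor_row b C x y : 'rV[K]_#|C| :=
  \row_l minor2 b x y (enum_val l).1 (enum_val l).2.

(* The coefficients at the edges of [H] of the products of the linear forms
   given by the columns [p] and [q] of [b], for [(p, q)] in [C]. *)
Definition minor_mx b H C := edge_mx H (minor_row b C).

Lemma minor_row_sym b C x y : minor_row b C y x = - minor_row b C x y.
Proof. by apply/rowP=> l; rewrite !mxE /minor2; ring. Qed.

(* [Shift_ij H] is the limit for [s -> 0] of [H] under the substitution that
   maps the variable [j] to [i + s j]. *)
Lemma minor_mx_shift b H C i j : i != j -> simple_graph H ->
  row_full (minor_mx b (shift i j H) C) -> exists b', row_full (minor_mx b' H C).
Proof.
move=> ij sH full.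
pose r := minor_row b C.
(* [mv] marks the edges that the shift really moves, and [sw] renames [j] to [i]. So [F0] carries
   the rows of the shifted graph, indexed by the edges of [H], and [F1] is the term of first order
   in [s]. *)
pose mv x y := [&& x == j, y != i & ~~ adj H i y] || [&& y == j, x != i & ~~ adj H i x].
pose sw x := if x == j then i else x.
pose F0 x y := if mv x y then r (sw x) (sw y) else r x y.
pose F1 x y := if mv x y then r x y else 0.
have mvC x y : mv y x = mv x y by rewrite /mv orbC.
have F0C x y : F0 y x = - F0 x y by rewrite /F0 mvC; case: ifP => _; apply: minor_row_sym.
have full0 : row_full (edge_mx H F0).
  have : (minor_mx b (shift i j H) C <= edge_mx H F0)%MS.
    have sub x y : adj H x y -> (F0 x y <= edge_mx H F0)%MS by move=> xy; apply: sub_edge_mx.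
    have key x y : x != y -> y != i -> y != j -> adj (shift i j H) x y ->
        (r x y <= edge_mx H F0)%MS.
      move=> xy yi yj.
      case: (eqVneq x j) => [->|xj].
        rewrite adj_shift_r // => /andP[jy iy]; have := sub _ _ jy.
        by rewrite /F0 /mv eqxx yi iy (negbTE yj).
      case: (eqVneq x i) => [->|xi]; last first.
        rewrite adj_shift_other // => a; have := sub _ _ a.
        by rewrite /F0 /mv (negbTE xj) (negbTE yj).
      rewrite adj_shift_l //; case iy: (adj H i y) => /=.
        move=> _; have := sub _ _ iy; by rewrite /F0 /mv (negbTE ij) (negbTE yj).
      move=> jy; have := sub _ _ jy; by rewrite /F0 /mv eqxx yi iy /= /sw eqxx (negbTE yj).
    have rC x y : (r y x <= edge_mx H F0)%MS = (r x y <= edge_mx H F0)%MS.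
      by rewrite /r minor_row_sym eqmx_opp.
    apply: edge_mx_sub => x y lt a; have xy : x != y by rewrite neq_ltn lt.
    rewrite -/r; case: (boolP ((y == i) || (y == j))) => [yij|]; last first.
      by rewrite negb_or => /andP[yi yj]; apply: key.
    case: (boolP ((x == i) || (x == j))) => [xij|]; last first.
      rewrite negb_or => /andP[xi xj]; rewrite -rC; apply: key => //; first by rewrite eq_sym.
      by rewrite adj_sym.
    have ijr : adj (shift i j H) i j -> (r i j <= edge_mx H F0)%MS.
      rewrite adj_shift_ij => /sub; by rewrite /F0 /mv (negbTE ij) !eqxx /=.
    case/orP: xij a xy => /eqP->; case/orP: yij => /eqP-> a; rewrite ?eqxx // => _.
      exact: ijr.
    by rewrite -rC; apply: ijr; rewrite adj_sym.
  by rewrite -!sub1mx in full *; apply: submx_trans.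
have [s s0] := row_full_perturb charK0 (edge_mx H F1) full0.
pose b' : 'M[K]_n := \matrix_(x, p) (if x == j then b i p + s * b j p else b x p).
move=> fulls; exists b'; rewrite -!sub1mx in fulls *; apply: submx_trans fulls _.
have sub x y : adj H x y -> (minor_row b' C x y <= minor_mx b' H C)%MS.
  by move=> xy; apply: sub_edge_mx => //; apply: minor_row_sym.
have -> : edge_mx H F0 + s *: edge_mx H F1 = edge_mx H (fun x y => F0 x y + s *: F1 x y).
  by apply/matrixP=> k l; rewrite !mxE.
have b'S x y : x != j -> y != j -> minor_row b' C x y = r x y.
  by move=> xj yj; apply/rowP=> l; rewrite !mxE /minor2 !mxE (negbTE xj) (negbTE yj).
have b'j y : y != j -> minor_row b' C j y = r i y + s *: r j y.
  by move=> yj; apply/rowP=> l; rewrite !mxE /minor2 !mxE eqxx (negbTE yj); ring.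
have rii : r i i = 0 by apply/rowP=> l; rewrite !mxE /minor2; ring.
(* For a moved edge [j y] the row of the pencil is the minor row of [b'] itself. For an unmoved one
   with [y != i], the edge [i y] is in [H], and subtracting its row and dividing by [s] leaves
   [r j y]. *)
have key y : adj H j y -> ((F0 j y + s *: F1 j y)%R <= minor_mx b' H C)%MS.
  move=> jy; have yj : y != j by rewrite eq_sym (adj_neq sH jy).
  have := sub _ _ jy; rewrite b'j // /F0 /F1 /mv eqxx (negbTE yj) /= orbF.
  case: (eqVneq y i) => [->|yi] /=.
    by rewrite rii add0r scaler0 addr0 eqmx_scale.
  case iy: (adj H i y) => /=; last by rewrite /sw eqxx (negbTE yj).
  have := sub _ _ iy; rewrite b'S // scaler0 addr0 => h1 h2.
  have -> : r j y = s^-1 *: ((r i y + s *: r j y) - r i y).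
    by rewrite addrC addKr scalerA mulVf // scale1r.
  by rewrite scalemx_sub // addmx_sub // eqmx_opp.
apply: edge_mx_sub => x y lt xy.
case: (eqVneq x j) => [ex|xj]; first by rewrite ex in xy *; apply: key.
case: (eqVneq y j) => [ey|yj].
  rewrite ey in xy *; have -> : F0 x j + s *: F1 x j = - (F0 j x + s *: F1 j x).
    rewrite F0C opprD /F1 mvC; congr (_ + _); case: ifP => _; last by rewrite scaler0 oppr0.
    by rewrite /r minor_row_sym scalerN.
  by rewrite eqmx_opp; apply: key; rewrite adj_sym.
by have := sub _ _ xy; rewrite b'S // /F0 /F1 /mv (negbTE xj) (negbTE yj) scaler0 addr0.
Qed.

Lemma minor_mx_shifts b s H C : simple_graph H ->
  all (fun p : 'I_n * 'I_n => p.1 < p.2)%N s ->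
  row_full (minor_mx b (shifts s H) C) -> exists b', row_full (minor_mx b' H C).
Proof.
elim: s H => [|[i j] s IH] H sH /=; first by exists b.
case/andP=> /= lt als full.
have [b1 full1] := IH (shift i j H) (simple_shift i j sH) als full.
by apply: minor_mx_shift full1; rewrite // neq_ltn lt.
Qed.

(** For the identity matrix the forms are the variables themselves; from here full rank is carried
    back along the shifts. *)
Lemma minor_mx1 D : row_full (minor_mx 1%:M D (pairs D)).
Proof.
suff -> : minor_mx 1%:M D (pairs D) = 1%:M by rewrite row_full_unit unitmx1.
apply/matrixP=> k l; rewrite !mxE /minor2 !mxE.
have := enum_valP k; have := enum_valP l; rewrite -(inj_eq enum_val_inj).
case: (enum_val k) => x y; case: (enum_val l) => p q /=.
rewrite !inE /= xpair_eqE => /andP[pq _] /andP[xy _].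
case: (eqVneq x p) => [ex|_] /=.
  rewrite ex in xy *; case: (eqVneq p q) pq => [->|_ _]; first by rewrite ltnn.
  by rewrite mul1r mul0r subr0.
rewrite mul0r sub0r; case: (eqVneq x q) => [ex|_]; last by rewrite mul0r oppr0.
case: (eqVneq y p) => [ey|_]; last by rewrite mulr0 oppr0.
by move: xy pq; rewrite ex ey; lia.
Qed.

End Minors.

(** * Generic matrices *)

Section PolyFun.
Variables (K : fieldType) (n : nat).
Implicit Types (F : 'M[K]_n -> K) (a : 'M[K]_n).

Definition polyfun F : Prop :=
  exists q : {mpoly K[n * n]}, forall a, F a = q.@[fun k => mxvec a 0 k].

Lemma polyfun_ext F F' : F =1 F' -> polyfun F -> polyfun F'.
Proof. by move=> FF [q Fq]; exists q => a; rewrite -FF. Qed.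

Lemma polyfun_cst c : polyfun (fun=> c).
Proof. by exists c%:MP => a; rewrite mevalC. Qed.

Lemma polyfun_coord i j : polyfun (fun a => a i j).
Proof. by exists 'X_(mxvec_index i j) => a; rewrite mevalXU mxvecE. Qed.

Lemma polyfunD F F' : polyfun F -> polyfun F' -> polyfun (fun a => F a + F' a).
Proof. by move=> [q Fq] [q' Fq']; exists (q + q') => a; rewrite Fq Fq' mevalD. Qed.

Lemma polyfunM F F' : polyfun F -> polyfun F' -> polyfun (fun a => F a * F' a).
Proof. by move=> [q Fq] [q' Fq']; exists (q * q') => a; rewrite Fq Fq' mevalM. Qed.

Lemma polyfunZ c F : polyfun F -> polyfun (fun a => c * F a).
Proof. by apply: polyfunM; apply: polyfun_cst. Qed.

Lemma polyfunB F F' : polyfun F -> polyfun F' -> polyfun (fun a => F a - F' a).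
Proof.
move=> pF pF'; apply: polyfunD => //; apply: polyfun_ext (polyfunZ (-1) pF') => a.
by rewrite mulN1r.
Qed.

Lemma polyfun_sum (I : finType) (F : I -> 'M[K]_n -> K) :
  (forall i, polyfun (F i)) -> polyfun (fun a => \sum_i F i a).
Proof.
move=> /fin_all_exists[q Fq]; exists (\sum_i q i) => a.
by rewrite raddf_sum; apply: eq_bigr => i _; rewrite Fq.
Qed.

Lemma polyfun_prod (I : finType) (F : I -> 'M[K]_n -> K) :
  (forall i, polyfun (F i)) -> polyfun (fun a => \prod_i F i a).
Proof.
move=> /fin_all_exists[q Fq]; exists (\prod_i q i) => a.
by rewrite rmorph_prod; apply: eq_bigr => i _; rewrite Fq.
Qed.

Lemma polyfun_det m (A : 'M[K]_n -> 'M[K]_m) :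
  (forall i j, polyfun (fun a => A a i j)) -> polyfun (fun a => \det (A a)).
Proof.
move=> pA; apply: polyfun_sum => s; apply: polyfunZ; apply: polyfun_prod => i; exact: pA.
Qed.

Lemma polyfun_adj i j : polyfun (fun a => (\adj a) i j).
Proof.
apply: (@polyfun_ext (fun a => cofactor a j i)) => [a|]; first by rewrite mxE.
apply: polyfunZ; apply: polyfun_det => k l.
apply: (@polyfun_ext (fun a => a (lift j k) (lift i l))) => [a|]; first by rewrite !mxE.
exact: polyfun_coord.
Qed.

Lemma polyfun_line F a a' : polyfun F ->
  exists p : {poly K}, forall s, F (a + s *: a') = p.[s].
Proof.
move=> [q Fq]; pose l k := (mxvec a 0 k)%:P + 'X * (mxvec a' 0 k)%:P.
exists (\sum_(m <- msupp q) q@_m *: \prod_k l k ^+ m k) => s.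
rewrite Fq mevalE horner_sum; apply: eq_bigr => m _; rewrite hornerZ; congr (_ * _).
rewrite horner_prod; apply: eq_bigr => k _; rewrite horner_exp; congr (_ ^+ _).
by rewrite /l hornerD hornerM hornerX !hornerC linearD linearZ /= !mxE.
Qed.

Definition open_at a0 (C : 'M[K]_n -> Prop) : Prop :=
  exists F, [/\ polyfun F, F a0 != 0 & forall a, F a != 0 -> C a].

Lemma open_at_and a0 C C' : open_at a0 C -> open_at a0 C' ->
  open_at a0 (fun a => C a /\ C' a).
Proof.
move=> [F [pF F0 FC]] [F' [pF' F0' FC']]; exists (fun a => F a * F' a).
split; first exact: polyfunM.
  by rewrite mulf_neq0.
by move=> a; rewrite mulf_eq0 negb_or => /andP[/FC Ca /FC' Ca'].
Qed.

Lemma open_at_all (I : finType) a0 (C : I -> 'M[K]_n -> Prop) :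
  (forall i, open_at a0 (C i)) -> open_at a0 (fun a => forall i, C i a).
Proof.
move=> /fin_all_exists[F FC]; exists (fun a => \prod_i F i a); split.
- by apply: polyfun_prod => i; case: (FC i).
- by apply/prodf_neq0 => i _; case: (FC i).
- move=> a /prodf_neq0 Fa i; case: (FC i) => _ _; apply; exact: Fa.
Qed.

Lemma open_at_row_full m p (A : 'M[K]_n -> 'M[K]_(m, p)) a0 :
  (forall i j, polyfun (fun a => A a i j)) -> row_full (A a0) ->
  open_at a0 (fun a => row_full (A a)).
Proof.
move=> pA /row_fullP[B BA]; exists (fun a => \det (B *m A a)); split.
- apply: polyfun_det => i j.
  apply: (@polyfun_ext (fun a => \sum_k B i k * A a k j)) => [a|]; first by rewrite mxE.
  by apply: polyfun_sum => k; apply: polyfunZ.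
- by rewrite BA det1 oner_eq0.
- move=> a d0; apply/row_fullP; exists (invmx (B *m A a) *m B).
  by rewrite -mulmxA mulVmx // unitmxE unitfE.
Qed.

Lemma open_at_unit a0 : a0 \in unitmx -> open_at a0 (fun a => a \in unitmx).
Proof.
move=> ua; exists (fun a => \det a); split; first by apply: polyfun_det => i j; apply: polyfun_coord.
  by rewrite -unitfE -unitmxE.
by move=> a; rewrite unitmxE unitfE.
Qed.

(* On the line through two points, two polynomials that do not vanish
   identically have a common non-zero. *)
Lemma open_at_meet a1 a2 C1 C2 : [pchar K] =i pred0 ->
  open_at a1 C1 -> open_at a2 C2 -> exists a, C1 a /\ C2 a.
Proof.
move=> charK0 [F1 [pF1 F10 FC1]] [F2 [pF2 F20 FC2]].
have [p1 ep1] := polyfun_line a1 (a2 - a1) pF1.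
have [p2 ep2] := polyfun_line a1 (a2 - a1) pF2.
have p0 : p1 * p2 != 0.
  rewrite mulf_neq0 //.
    by apply: contraNneq F10 => p10; rewrite -[a1]addr0 -(scale0r (a2 - a1)) ep1 p10 horner0.
  apply: contraNneq F20 => p20.
  by rewrite -[a2](subrKC a1) -[a2 - a1]scale1r ep2 p20 horner0.
have [s] := exists_nonroot charK0 p0; rewrite hornerM mulf_eq0 negb_or -ep1 -ep2.
by case/andP=> /FC1 c1 /FC2 c2; exists (a1 + s *: (a2 - a1)).
Qed.

End PolyFun.

(** A kernel vector lists the coefficients of a polynomial with fewer than [k.+1] coefficients and
    [m >= k] distinct roots. *)
Lemma row_full_vandermonde (K : fieldType) m k (f : 'I_m -> K) :
  injective f -> (k <= m)%N -> row_full (\matrix_(i < m, p < k) f i ^+ p).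
Proof.
move=> f_inj km; set A := (\matrix_(i, p) _).
rewrite /row_full -mxrank_tr -/(row_free A^T).
rewrite -kermx_eq0; apply/rowV0P=> v /sub_kermxP vA.
pose P := \poly_(p < k) (if insub p is Some q then v 0 q else 0).
have rP i : root P (f i).
  rewrite /root horner_poly; apply/eqP.
  have /rowP/(_ i) := vA; rewrite !mxE => e; rewrite -[RHS]e.
  by apply: eq_bigr => p _; rewrite valK !mxE.
have P0 : P = 0.
  apply/eqP/negPn/negP=> nP.
  have /(max_poly_roots nP) : all (root P) [seq f i | i <- enum 'I_m].
    by apply/allP=> _ /mapP[i _ ->]; apply: rP.
  rewrite map_inj_uniq ?enum_uniq // size_map size_enum_ord => /(_ isT).
  by rewrite ltnNge (leq_trans (size_poly _ _) km).
apply/rowP=> p; rewrite mxE; have := congr1 (fun P : {poly K} => P`_p) P0.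
by rewrite coef_poly coef0 ltn_ord valK.
Qed.

Section Good.
Variables (K : fieldType) (n : nat).
Hypothesis charK0 : [pchar K] =i pred0.
Implicit Types (a b : 'M[K]_n) (N : {set 'I_n}) (G D : {set {set 'I_n}}).

Definition sub_cols b N (k : 'I_n.+1) : 'M[K]_(#|N|, k) :=
  \matrix_(i < #|N|, p < k) b (enum_val i) (widen_ord (leq_ord k) p).

(** The second clause serves for [t.1] the later neighbours of a vertex. With [t] ranging over a
    finite type it is a finite intersection of open conditions. *)
Definition generic_mx G D b : Prop :=
  row_full (minor_mx b G (pairs D)) /\
  forall t : {set 'I_n} * 'I_n.+1, (t.2 <= #|t.1|)%N -> row_full (sub_cols b t.1 t.2).

Lemma generic_mx_scale G D b c : c != 0 -> generic_mx G D b -> generic_mx G D (c *: b).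
Proof.
move=> c0 [f1 f2]; split=> [|t /f2].
  have -> : minor_mx (c *: b) G (pairs D) = (c ^+ 2) *: minor_mx b G (pairs D).
    by apply/matrixP=> k l; rewrite !mxE /minor2 !mxE; ring.
  by rewrite -!sub1mx in f1 *; rewrite eqmx_scale // expf_neq0.
have -> : sub_cols (c *: b) t.1 t.2 = c *: sub_cols b t.1 t.2.
  by apply/matrixP=> k l; rewrite !mxE.
by rewrite -!sub1mx eqmx_scale.
Qed.

Lemma exists_generic_mx G D b1 : row_full (minor_mx b1 G (pairs D)) ->
  exists b, b \in unitmx /\ generic_mx G D b.
Proof.
move=> full1.
(* The two clauses have different witnesses: [b1] for the minors, and a Vandermonde matrix for the
   columns, since any of its rows restricted to the first columns are again of Vandermonde type. Its
   nodes are distinct in characteristic 0. *)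
pose bV : 'M[K]_n := \matrix_(x, p) (x%:R ^+ p).
have inj_nat (m : nat) (g : 'I_m -> 'I_n) : injective g -> injective (fun i => (g i)%:R : K).
  by move=> g_inj i j /(natr_inj_pchar0 charK0)/val_inj/g_inj.
have uV : bV \in unitmx.
  rewrite -row_full_unit; apply: (@row_full_vandermonde K n n (fun i => i%:R)) => //.
  exact: (inj_nat n id).
have cV (t : {set 'I_n} * 'I_n.+1) : (t.2 <= #|t.1|)%N -> row_full (sub_cols bV t.1 t.2).
  move=> kN; have := row_full_vandermonde (inj_nat _ _ (@enum_val_inj _ (mem t.1))) kN.
  by congr (row_full _); apply/matrixP=> i p; rewrite !mxE.
have o1 : open_at b1 (fun b => row_full (minor_mx b G (pairs D))).
  apply: open_at_row_full full1 => k l.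
  apply: (@polyfun_ext _ _ (fun b => minor2 b (enum_val k).1 (enum_val k).2 (enum_val l).1 (enum_val l).2)).
    by move=> a; rewrite !mxE.
  by apply: polyfunB; apply: polyfunM; apply: polyfun_coord.
have o2 : open_at bV (fun b => forall t : {set 'I_n} * 'I_n.+1, (t.2 <= #|t.1|)%N -> row_full (sub_cols b t.1 t.2)).
  apply: open_at_all => t; case: (leqP t.2 #|t.1|) => kN; last first.
    exists (fun=> 1); split=> //; first exact: polyfun_cst.
    exact: oner_neq0.
  have [|F [pF F0 FC]] := @open_at_row_full K n _ _ (fun b => sub_cols b t.1 t.2) bV _ (cV t kN).
    move=> i p; apply: (@polyfun_ext _ _ (fun b => b (enum_val i) (widen_ord (leq_ord t.2) p))).
      by move=> b; rewrite !mxE.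
    exact: polyfun_coord.
  by exists F; split=> // a /FC.
have [b [c1 [c2 c3]]] := open_at_meet charK0 o1 (open_at_and (open_at_unit uV) o2).
by exists b.
Qed.

Lemma open_generic_adj G D a0 : generic_mx G D (\adj a0) ->
  open_at a0 (fun a => generic_mx G D (\adj a)).
Proof.
move=> [f1 f2]; apply: open_at_and.
  apply: (@open_at_row_full _ _ _ _ (fun a => minor_mx (\adj a) G (pairs D))) => // k l.
  apply: (@polyfun_ext _ _ (fun a => minor2 (\adj a) (enum_val k).1 (enum_val k).2 (enum_val l).1 (enum_val l).2)).
    by move=> a; rewrite !mxE.
  by apply: polyfunB; apply: polyfunM; apply: polyfun_adj.
apply: open_at_all => t; case: (leqP t.2 #|t.1|) => kN; last first.
  exists (fun=> 1); split=> //; first exact: polyfun_cst.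
  exact: oner_neq0.
have [|F [pF F0 FC]] := @open_at_row_full K n _ _ (fun a => sub_cols (\adj a) t.1 t.2) a0 _ (f2 t kN).
  move=> i p; apply: (@polyfun_ext _ _ (fun a => (\adj a) (enum_val i) (widen_ord (leq_ord t.2) p))).
    by move=> b; rewrite [RHS]mxE.
  exact: polyfun_adj.
by exists F; split=> // a /FC.
Qed.

(* The inverse matrix is a multiple of the adjugate, whose entries are
   polynomials. *)
Lemma zariski_generic G D b1 : row_full (minor_mx b1 G (pairs D)) ->
  exists U : 'M[K]_n -> Prop, [/\ zariski_open U, exists a, U a
    & forall a, U a -> a \in unitmx /\ generic_mx G D (invmx a)].
Proof.
move=> /exists_generic_mx[b0 [ub0 gb0]].
have inv_adj a : a \in unitmx -> invmx a = (\det a)^-1 *: \adj a.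
  by move=> ua; rewrite /invmx ua.
have det0 a : a \in unitmx -> \det a != 0 by rewrite unitmxE unitfE.
pose a0 := invmx b0; have ua0 : a0 \in unitmx by rewrite unitmx_inv.
have g0 : generic_mx G D (\adj a0).
  have -> : \adj a0 = \det a0 *: b0.
    by rewrite -[b0]invmxK -/a0 inv_adj // scalerA mulfV ?scale1r // det0.
  by apply: generic_mx_scale gb0; apply: det0.
have [F [[q Fq] F0 FC]] := open_generic_adj g0.
exists (fun a => a \in unitmx /\ F a != 0); split.
- exists (fun p => p = q) => a; split=> [[ua Fa]|[ua [p -> qa]]]; split=> //.
    by exists q => //; rewrite -Fq.
  by rewrite Fq.
- by exists a0.
- move=> a [ua Fa]; split=> //; rewrite inv_adj //; apply: generic_mx_scale.
    by rewrite invr_eq0 det0.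
  exact: FC.
Qed.

End Good.

(** * Stresses *)

Section Stress.
Variables (K : fieldType) (n : nat) (G : {set {set 'I_n}}) (b : 'M[K]_n).
Implicit Types (k : 'I_n.+1) (vs t : seq 'I_n) (x y p q : 'I_n) (w : 'M[K]_n).

Definition first_cols k : 'M[K]_(n, k) := \matrix_(y, p) b y (widen_ord (leq_ord k) p).

(** A stress in the sense of Kalai's hyperconnectivity: a skew weighting of the edges whose weighted
    sum of vectors vanishes at every vertex, vertex [y] carrying the first [k] entries of row [y] of
    [b]. *)
Definition stress k vs w : Prop :=
  [/\ forall x y, w y x = - w x y, forall x, w x x = 0,
      forall x y, w x y != 0 -> x != y -> [/\ x \in vs, y \in vs & adj G x y]
    & w *m first_cols k = 0].

Lemma stress_cons k v t w : stress k t w -> stress k (v :: t) w.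
Proof.
move=> [sk dg su an]; split=> // x y wxy xy; have [xt yt a] := su x y wxy xy.
by rewrite !inE xt yt !orbT.
Qed.

(* Over the clique spanned by [v] and its [c] later neighbours, with [h0] a
   fixed relation with coefficient 1 at [v], the stresses [h0 /\ h] for the
   relations [h] between the neighbours form a space of dimension [c - k]. *)
Lemma stress_family k vs : uniq vs -> peo (adj G) vs ->
  (forall N : {set 'I_n}, (k <= #|N|)%N -> row_full (sub_cols b N k)) ->
  exists e (S : 'I_e -> 'M[K]_n),
    [/\ (\sum_(c <- backdeg (adj G) vs) (c - k) <= e)%N, forall i, stress k vs (S i)
      & forall c : 'I_e -> K, \sum_i c i *: S i = 0 -> forall i, c i = 0].
Proof.
move=> + + gen; elim: vs => [|v t IH] /= => [_ _|/andP[vt ut] [sv pt]].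
  by exists 0, (fun=> 0); split=> [||c _ []]; rewrite ?big_nil //; case.
have [e [S [le_e stS freeS]]] := IH ut pt.
pose N := [set x | (x \in t) && adj G v x].
have cN : count (adj G v) t = #|N|.
  rewrite -size_filter -(card_uniqP _) ?filter_uniq //.
  by apply: eq_card => x; rewrite mem_filter inE andbC.
rewrite big_cons cN; case: (leqP #|N| k) => kN.
  exists e, S; split=> //; first by move: kN; rewrite -subn_eq0 => /eqP->.
  by move=> i; apply: stress_cons.
pose A := sub_cols b N k; pose F := first_cols k.
pose In : 'M[K]_(#|N|, n) := \matrix_(i, x) (x == enum_val i)%:R.
have InF : In *m F = A.
  apply/matrixP=> i p; rewrite !mxE (bigD1 (enum_val i)) //= !mxE eqxx mul1r.
  by rewrite big1 ?addr0 // => x /negbTE xi; rewrite !mxE xi mul0r.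
have InIn : In *m In^T = 1%:M.
  apply/matrixP=> i j; rewrite !mxE (bigD1 (enum_val i)) //= !mxE eqxx mul1r.
  rewrite (inj_eq enum_val_inj) big1 ?addr0 // => x /negbTE xi; by rewrite !mxE xi mul0r.
have InE (y : 'rV_#|N|) x : x \notin N -> (y *m In) 0 x = 0.
  move=> xN; rewrite mxE big1 // => i _; rewrite mxE.
  case: eqP => [e0|]; last by rewrite mulr0.
  by move: xN; rewrite e0 enum_valP.
(* The vector of [v] is a combination of those of its later neighbours, which gives the relation
   [h0]; the rows of [Y] are a basis of the relations among these neighbours alone. *)
have [c0 c0A] : exists c0, row v F = c0 *m A.
  by apply/submxP; apply: submx_full; apply: gen; apply: ltnW.
pose Y := row_base (kermx A).
have YA : Y *m A = 0 by apply/sub_kermxP; rewrite eq_row_base.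
have freeY : row_free Y by apply: row_base_free.
pose h0 : 'rV[K]_n := delta_mx 0 v - c0 *m In.
pose h i : 'rV[K]_n := row i Y *m In.
have vN : v \notin N by rewrite inE (negbTE vt).
have h0D x : h0 0 x = (x == v)%:R - (c0 *m In) 0 x.
  by rewrite [LHS]mxE [X in _ + X]mxE [X in X - _]mxE.
have h0v : h0 0 v = 1 by rewrite h0D eqxx InE // subr0.
have h0F : h0 *m F = 0 by rewrite mulmxBl -rowE c0A -mulmxA InF subrr.
have hF i : h i *m F = 0 by rewrite -mulmxA InF -row_mul YA row0.
have h0E x : h0 0 x != 0 -> (x == v) || (x \in N).
  rewrite h0D; case: (eqVneq x v) => //= _; rewrite sub0r oppr_eq0.
  by apply: contraR => xN; rewrite InE.
have hE i x : h i 0 x != 0 -> x \in N.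
  by apply: contraR => xN; rewrite InE.
pose om i : 'M[K]_n := h0^T *m h i - (h i)^T *m h0.
have omE i x y : om i x y = h0 0 x * h i 0 y - h i 0 x * h0 0 y.
  by rewrite !mxE !big_ord1 !mxE.
have Nadj x y : (x == v) || (x \in N) -> (y == v) || (y \in N) -> x != y ->
    [/\ x \in v :: t, y \in v :: t & adj G x y].
  rewrite !inE => /orP[/eqP->|/andP[xt vx]] /orP[/eqP->|/andP[yt vy]];
    rewrite ?eqxx ?xt ?yt ?orbT // => xy; split=> //.
    by rewrite adj_sym.
  exact: sv.
have st_om i : stress k (v :: t) (om i).
  split.
  - by move=> x y; rewrite !omE; ring.
  - by move=> x; rewrite !omE; ring.
  - move=> x y; rewrite omE => nz xy.
    have [|] := eqVneq (h0 0 x * h i 0 y) 0 => [z|].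
      move: nz; rewrite z sub0r oppr_eq0 mulf_eq0 negb_or => /andP[/hE xN /h0E yN].
      by apply: Nadj; rewrite // xN orbT.
    rewrite mulf_eq0 negb_or => /andP[/h0E xN /hE yN].
    by apply: Nadj; rewrite // yN orbT.
  - by rewrite -/F /om mulmxBl -(mulmxA h0^T) -(mulmxA (h i)^T) hF h0F !mulmx0 subrr.
pose S' j := match split j with inl i => om i | inr i => S i end.
exists (\rank (kermx A) + e)%N, S'; split.
- by rewrite leq_add // mxrank_ker leq_sub2l // rank_leq_col.
- by move=> j; rewrite /S'; case: split => i //; apply: stress_cons.
move=> c; rewrite big_split_ord /=.
have -> : \sum_i c (lshift e i) *: S' (lshift e i) = \sum_i c (lshift e i) *: om i.
  by apply: eq_bigr => i _; rewrite /S' (unsplitK (inl i)).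
have -> : \sum_i c (rshift (\rank (kermx A)) i) *: S' (rshift _ i) =
          \sum_i c (rshift (\rank (kermx A)) i) *: S i.
  by apply: eq_bigr => i _; rewrite /S' (unsplitK (inr i)).
move=> sum0.
(* Row [v] isolates the new stresses: the old ones vanish there, and row [v] of [om i] is [h i],
   because [h0] is 1 and [h i] is 0 at [v]. *)
have cl i : c (lshift e i) = 0.
  pose cv : 'rV[K]__ := \row_i c (lshift e i).
  suff : cv = 0 by move/rowP/(_ i); rewrite !mxE.
  have : cv *m Y *m In = 0.
    apply/rowP=> y; have /matrixP/(_ v y) := sum0; rewrite mxE !summxE.
    rewrite [X in _ + X]big1 ?addr0 => [eq0|j _]; last first.
      rewrite mxE; case: (stS j) => _ dg su _.
      case: (eqVneq v y) => [<-|vy]; first by rewrite dg mulr0.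
      case: (eqVneq (S j v y) 0) => [->|nz]; first by rewrite mulr0.
      by have [vt' _ _] := su v y nz vy; rewrite vt' in vt.
    rewrite [RHS]mxE; rewrite [RHS]mxE in eq0; rewrite -[RHS]eq0 -mulmxA [LHS]mxE.
    apply: eq_bigr => j _; rewrite [RHS]mxE omE h0v mul1r (InE _ v vN) mul0r subr0.
    by rewrite /h -row_mul [cv 0 j]mxE [RHS in _ = _ * RHS]mxE.
  move/(congr1 (mulmx^~ In^T)); rewrite mul0mx -mulmxA InIn mulmx1.
  move/eqP; rewrite mulmx_free_eq0 // => /eqP; exact.
move=> i; case: (splitP i) => j ij.
  by have -> : i = lshift e j by apply: val_inj.
have -> : i = rshift (\rank (kermx A)) j by apply: val_inj.
apply: (freeS (fun i => c (rshift (\rank (kermx A)) i))); rewrite -[RHS]sum0 [X in _ = X + _]big1 ?add0r // => l _.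
by rewrite cl scale0r.
Qed.

(** The value at f_p f_q of the linear functional [w] on the degree-two part modulo J_G, where f_p
    is the form given by column [p] of [b]. *)
Definition pairing (w : 'rV[K]_#|pairs G|) p q : K :=
  \sum_k w 0 k * minor2 b (enum_val k).1 (enum_val k).2 p q.

Lemma minor_mxE (w : 'rV[K]_#|pairs G|) (C : {set 'I_n * 'I_n}) l :
  (w *m minor_mx b G C) 0 l = pairing w (enum_val l).1 (enum_val l).2.
Proof. by rewrite mxE; apply: eq_bigr => k _; rewrite !mxE. Qed.

Lemma pairingD (w w' : 'rV[K]_#|pairs G|) p q : pairing (w + w') p q = pairing w p q + pairing w' p q.
Proof. by rewrite -big_split; apply: eq_bigr => k _; rewrite mxE mulrDl. Qed.

Lemma pairingZ c (w : 'rV[K]_#|pairs G|) p q : pairing (c *: w) p q = c * pairing w p q.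
Proof. by rewrite mulr_sumr; apply: eq_bigr => k _; rewrite mxE mulrA. Qed.

(** The two orientations of an edge give the two terms of its minor. In this bilinear form, a column
    annihilated by [w] visibly gives 0. *)
Lemma pairing_form (w : 'M[K]_n) p q :
  (forall x y, w y x = - w x y) -> (forall x, w x x = 0) ->
  (forall x y, w x y != 0 -> x != y -> adj G x y) ->
  pairing (\row_k w (enum_val k).1 (enum_val k).2) p q =
  \sum_x \sum_y b x p * w x y * b y q.
Proof.
move=> sk dg su; rewrite pair_big /=.
pose f (z : 'I_n * 'I_n) := b z.1 p * w z.1 z.2 * b z.2 q.
rewrite -[RHS]/(\sum_z f z) (bigID (fun z : 'I_n * 'I_n => z.1 < z.2)%N) /=.
rewrite [X in _ = _ + X](bigID (fun z : 'I_n * 'I_n => z.2 < z.1)%N) /=.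
rewrite [X in _ = _ + (_ + X)]big1 ?addr0; last first.
  move=> [x y]; rewrite -!leqNgt /= => /andP[yx xy].
  have -> : x = y by apply: val_inj; apply/eqP; rewrite eqn_leq yx xy.
  by rewrite /f /= dg mulr0 mul0r.
rewrite [X in _ = _ + X](reindex_inj (h := fun z : 'I_n * 'I_n => (z.2, z.1))) /=; last first.
  by move=> [x y] [x' y'] [-> ->].
rewrite [X in _ = _ + X](eq_bigl (fun z : 'I_n * 'I_n => z.1 < z.2)%N); last first.
  by move=> [x y] /=; case: (ltngtP x y).
rewrite -big_split /=.
pose g (z : 'I_n * 'I_n) := w z.1 z.2 * minor2 b z.1 z.2 p q.
transitivity (\sum_(z in pairs G) g z).
  by rewrite big_enum_val; apply: eq_bigr => k _; rewrite mxE.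
rewrite [RHS](bigID (fun z => adj G z.1 z.2)) /= [X in _ = _ + X]big1 ?addr0.
  apply: eq_big => [z|[x y] _]; first by rewrite inE.
  by rewrite /f /g /minor2 /= (sk x y); ring.
move=> [x y] /= /andP[xy nadj]; rewrite /f /= (sk x y).
have -> : w x y = 0.
  by apply/eqP; apply: contraNT nadj => nz; apply: su => //; rewrite neq_ltn xy.
by rewrite oppr0 !mulr0 !mul0r addr0.
Qed.

Lemma pairing_stress k vs (w : 'M[K]_n) p q : stress k vs w -> (p < k)%N ->
  pairing (\row_k w (enum_val k).1 (enum_val k).2) p q = 0.
Proof.
move=> [sk dg su an] pk; rewrite pairing_form //; last by move=> x y nz xy; case: (su x y nz xy).
rewrite exchange_big big1 //= => y _; rewrite -mulr_suml.
have /matrixP/(_ y (Ordinal pk)) := an; rewrite !mxE => e0.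
suff -> : \sum_x b x p * w x y = 0 by rewrite mul0r.
rewrite -[RHS]oppr0 -[in RHS]e0 -sumrN; apply: eq_bigr => x _.
rewrite mxE (sk x y) mulNr opprK mulrC; congr (_ * b _ _); exact: val_inj.
Qed.

End Stress.

(** * Stresses against the rows of D *)

Section RowsPairing.
Variables (K : fieldType) (n : nat) (G : {set {set 'I_n}}) (b : 'M[K]_n) (r : nat -> nat).
Let D := rows_graph n 0 r.
Hypotheses (simpleG : simple_graph G) (chordalG : chordal_rows G setT r).
Hypotheses (cardGD : #|G| = #|D|) (genb : generic_mx G D b).
Implicit Types (x y p q : 'I_n).

(** Double counting: a vertex of back-degree [c] contributes to the rows [x] with [k <= x < c], at
    most [c - k] of them. Cutting rows off at [n] can only lower the left side. *)
Lemma card_rows_above k vs :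
  (forall i, count (ltn i) (backdeg (adj G) vs) = r i) ->
  (#|[set p in pairs D | (k <= p.1)%N]| <= \sum_(c <- backdeg (adj G) vs) (c - k))%N.
Proof.
move=> er; set B := backdeg _ _ in er *.
have le_c (c m : nat) : (\sum_(x < n | (k <= x)%N) (x < c)%N <= c - k)%N.
  rewrite big_mkcond /=.
  have -> : (\sum_(i < n) (if (k <= i)%N then ((i < c)%N : nat) else 0) = #|[set x : 'I_n | (k <= x < minn c n)%N]|)%N.
    rewrite -sum1_card [RHS]big_mkcond /=; apply: eq_bigr => x _.
    by rewrite inE leq_min ltn_ord andbT; case: (k <= x)%N => //=; case: (x < c)%N.
  by rewrite card_interval ?geq_minr // leq_sub2r // geq_minl.
apply: (@leq_trans (\sum_(x < n | (k <= x)%N) r x)%N); last first.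
  rewrite (eq_bigr (fun x : 'I_n => \sum_(c <- B) (x < c)%N)%N); last first.
    by move=> x _; rewrite -er -sum1_count big_mkcond.
  by rewrite exchange_big /=; apply: leq_sum => c _; apply: le_c.
rewrite -sum1_card.
have -> : (\sum_(p in [set p in pairs D | (k <= p.1)%N]) 1 =
   \sum_(x < n | (k <= x)%N) \sum_(y < n | ((x, y) \in pairs D)) 1)%N.
  rewrite pair_big_dep /=; apply: eq_bigl => -[x y]; rewrite !inE /=.
  by rewrite andbC.
apply: leq_sum => x kx.
have -> : (\sum_(y < n | (x, y) \in pairs D) 1 = #|[set y : 'I_n | (x.+1 <= y < minn n (x + r x).+1)%N]|)%N.
  rewrite -sum1_card; apply: eq_bigl => y; rewrite !inE /=.
  case xy: (x < y)%N => //=; rewrite adj_rows_graph // subn0 /= leq_min ltn_ord /= ltnS; done.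
by rewrite card_interval ?geq_minl // leq_subLR; apply: leq_trans (geq_minr _ _) _; rewrite addSn.
Qed.

Lemma card_pairs_eq : #|pairs G| = #|pairs D|.
Proof. by rewrite !card_pairs //; exact: simple_rows_graph. Qed.

Lemma minor_mx_free : row_free (minor_mx b G (pairs D)).
Proof. by rewrite /row_free [X in _ == X]card_pairs_eq; case: genb. Qed.

Lemma pairing_inj (w : 'rV[K]_#|pairs G|) :
  (forall p : 'I_n * 'I_n, p \in pairs D -> pairing b w p.1 p.2 = 0) -> w = 0.
Proof.
move=> w0; apply/eqP; rewrite -(mulmx_free_eq0 _ minor_mx_free); apply/eqP/rowP=> l.
by rewrite minor_mxE mxE; apply: w0; apply: enum_valP.
Qed.

Lemma pairing_sum (e : nat) (E : 'M[K]_(e, #|pairs G|)) (z : 'rV_e) p q :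
  pairing b (z *m E) p q = \sum_i z 0 i * pairing b (row i E) p q.
Proof.
under [RHS]eq_bigr do rewrite mulr_sumr; rewrite exchange_big /=.
apply: eq_bigr => k _; rewrite mxE mulr_suml; apply: eq_bigr => i _.
by rewrite !mxE mulrA.
Qed.

(* There are as many stresses as the rows of [D] from the [k]-th on have edges,
   so the forms vanishing on the first rows of [D] are all stresses. *)
Lemma pairing_rows_eq0 (k : 'I_n.+1) (w : 'rV[K]_#|pairs G|) :
  (forall p : 'I_n * 'I_n, p \in pairs D -> (p.1 < k)%N -> pairing b w p.1 p.2 = 0) ->
  forall p q, (p < k)%N -> pairing b w p q = 0.
Proof.
move=> w0 p q pk.
have [vs [uvs vsT pvs er]] := chordalG.
have gen (N : {set 'I_n}) : (k <= #|N|)%N -> row_full (sub_cols b N k).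
  by move=> kN; case: genb => _ /(_ (N, k)); apply.
have [e [S [le_e stS freeS]]] := stress_family uvs pvs gen.
pose E : 'M[K]_(e, #|pairs G|) := \matrix_(i, j) S i (enum_val j).1 (enum_val j).2.
have rowE i : row i E = \row_j S i (enum_val j).1 (enum_val j).2.
  by apply/rowP=> j; rewrite !mxE.
have Ek (z : 'rV_e) x y : (x < k)%N -> pairing b (z *m E) x y = 0.
  move=> xk; rewrite pairing_sum big1 // => i _.
  by rewrite rowE (pairing_stress _ (stS i)) // mulr0.
have E_inj (z : 'rV_e) : z *m E = 0 -> z = 0.
  move=> zE; apply/rowP=> i; rewrite mxE; apply: (freeS (fun i => z 0 i)).
  have main x y : (x < y)%N -> (\sum_i z 0 i *: S i) x y = 0.
    move=> xy; case: (boolP ((x, y) \in pairs G)) => [xyG|nG].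
      have /rowP/(_ (enum_rank_in xyG (x, y))) := zE; rewrite !mxE => e0.
      rewrite summxE -[RHS]e0; apply: eq_bigr => j _.
      by rewrite !mxE enum_rankK_in.
    rewrite summxE big1 // => j _; rewrite mxE; case: (stS j) => _ _ su _.
    case: (eqVneq (S j x y) 0) => [->|nz]; first by rewrite mulr0.
    have xy' : x != y by rewrite neq_ltn xy.
    by case: (su x y nz xy') => _ _ a; case/negP: nG; rewrite inE /= xy.
  apply/matrixP=> x y; rewrite [RHS]mxE; case: (ltngtP x y) => [/main//|yx|/val_inj->].
    rewrite -[RHS]oppr0 -[in RHS](main _ _ yx) !summxE -sumrN; apply: eq_bigr => j _.
    by rewrite !mxE; case: (stS j) => sk _ _ _; rewrite (sk y x) mulrN.
  by rewrite summxE big1 // => j _; rewrite mxE; case: (stS j) => _ -> _ _; rewrite mulr0.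
pose C := [set p in pairs D | (k <= p.1)%N].
(* [Q] evaluates the stresses at the edges of [D] in rows from [k] on. Its rows are independent,
   since stresses vanish on the earlier rows and a form vanishing on all of [D] is 0; by the count
   it has at least as many rows as columns, hence full column rank. *)
pose Q := E *m minor_mx b G C.
have CE (v : 'rV_#|pairs G|) : v *m minor_mx b G C = 0 -> forall p : 'I_n * 'I_n, p \in C -> pairing b v p.1 p.2 = 0.
  move=> v0 c cC; have /rowP/(_ (enum_rank_in cC c)) := v0.
  by rewrite minor_mxE mxE enum_rankK_in.
have freeQ : row_free Q.
  rewrite -kermx_eq0; apply/rowV0P=> z /sub_kermxP; rewrite mulmxA => zQ.
  apply: E_inj; apply: pairing_inj => c cD; case: (leqP k c.1) => kc; last exact: Ek.
  by apply: CE => //; rewrite inE cD.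
have fullQ : row_full Q.
  rewrite /row_full eqn_leq rank_leq_col /= (eqP freeQ); apply: leq_trans le_e.
  exact: card_rows_above.
(* A stress agreeing with [w] on the later rows agrees with it on all of [D], hence equals [w]. *)
have /submxP[z zQ] : (w *m minor_mx b G C <= Q)%MS by apply: submx_full.
suff -> : w = z *m E by apply: Ek.
apply/eqP; rewrite -subr_eq0; apply/eqP; apply: pairing_inj => c cD.
case: (leqP k c.1) => kc; last first.
  by rewrite pairingD w0 // -scaleN1r pairingZ Ek // mulr0 addr0.
apply: CE; last by rewrite inE cD.
by rewrite mulmxBl zQ mulmxA subrr.
Qed.

End RowsPairing.

(** * Linear substitutions in the exterior algebra *)

Section SortedOrd.
Variable n : nat.
Implicit Types (i j : 'I_n) (s : seq 'I_n).

Definition ord_ltn : rel 'I_n := fun i j => (i < j)%N.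

Lemma ord_ltn_trans : transitive ord_ltn.
Proof. by move=> j i k; apply: ltn_trans. Qed.

Lemma sorted_enum_set (S : {set 'I_n}) : sorted ord_ltn (enum S).
Proof.
rewrite {1}/enum_mem; apply: sorted_filter; first exact: ord_ltn_trans.
rewrite -enumT; have := iota_ltn_sorted 0 n; rewrite -val_enum_ord sorted_map.
by apply: sub_sorted.
Qed.

Lemma sorted_enum s : sorted ord_ltn s -> enum [set j in s] = s.
Proof.
move=> ss; apply: irr_sorted_eq (sorted_enum_set _) ss _; first exact: ord_ltn_trans.
  by move=> i; apply: ltnn.
by move=> i; rewrite mem_enum inE.
Qed.

End SortedOrd.

Section Words.
Variables (K : fieldType) (n : nat).
Notation E := (exterior K n).
Implicit Types (i j p q : 'I_n) (s : seq 'I_n) (S T : {set 'I_n}) (x : 'I_n -> E) (f g h : E).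
Implicit Types (a b : 'M[K]_n).

Definition anticommuting x : Prop :=
  (forall i, x i * x i = 0) /\ (forall i j, x j * x i = - (x i * x j)).

Lemma insert_word i s : sorted (@ord_ltn n) s -> exists c s',
  [/\ sorted (@ord_ltn n) s', {subset s' <= i :: s}
    & forall x, anticommuting x -> x i * \prod_(j <- s) x j = c *: \prod_(j <- s') x j].
Proof.
elim: s => [_|j s IH] /=.
  by exists 1, [:: i]; split=> // x _; rewrite big_seq1 big_nil mulr1 scale1r.
move=> js; have := js; rewrite path_sortedE; last exact: ord_ltn_trans.
case/andP=> aj ss; case: (ltngtP i j) => [ij|ji|/val_inj <-].
- exists 1, (i :: j :: s); split=> //=; first by rewrite js andbT.
  by move=> x _; rewrite !big_cons scale1r.
- have [c [s' [ss' sub eqx]]] := IH ss.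
  exists (- c), (j :: s'); split.
  + rewrite /= path_sortedE; last exact: ord_ltn_trans.
    rewrite ss' andbT; apply/allP=> k /sub; rewrite inE => /orP[/eqP->//|].
    exact: (allP aj).
  + by move=> k; rewrite !inE => /orP[->|/sub]; rewrite ?orbT // inE => /orP[->|->]; rewrite ?orbT.
  + move=> x ax; have [_ ac] := ax; rewrite !big_cons mulrA ac mulNr -mulrA eqx // scaleNr.
    by rewrite -scalerAr.
- exists 0, [::]; split=> // x [sq _].
  by rewrite !big_cons mulrA sq mul0r scale0r.
Qed.

(** The order of quantifiers is the point: [c] and [S] depend only on the word, so the same normal
    form holds for the generators and for their images. This is what makes [ext_act]
    multiplicative. *)
Lemma sort_word s : exists c S, forall x, anticommuting x ->
  \prod_(j <- s) x j = c *: \prod_(j <- enum S) x j.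
Proof.
suff [c [s' [ss' eqx]]] : exists c s', sorted (@ord_ltn n) s' /\ forall x, anticommuting x ->
    \prod_(j <- s) x j = c *: \prod_(j <- s') x j.
  by exists c, [set j in s'] => x ax; rewrite sorted_enum // eqx.
elim: s => [|i s [c [s' [ss' eqx]]]]; first by exists 1, [::]; split=> // x _; rewrite scale1r.
have [c' [s'' [ss'' _ eqx']]] := insert_word i ss'.
exists (c * c'), s''; split=> // x ax.
by rewrite big_cons eqx // -scalerAr eqx' // scalerA.
Qed.

Lemma prod_ext_gen S : \prod_(j <- enum S) ext_gen K j = ext_mono K S.
Proof.
have -> : ext_mono K S = ext_mono K [set j in enum S].
  by congr ext_mono; apply/setP=> j; rewrite inE mem_enum.
elim: (enum S) (sorted_enum_set S) => [_|i s IH] /=.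
  by rewrite big_nil; congr ext_mono; apply/setP=> j; rewrite !inE.
rewrite path_sortedE; last exact: ord_ltn_trans.
case/andP=> /allP ai ss; rewrite big_cons IH // [LHS]ext_mul_mono.
have -> : [set j in i :: s] = [set i] :|: [set j in s].
  by apply/setP=> j; rewrite !inE.
rewrite /ext_sign disjoints1 inE; have -> : i \in s = false.
  by apply/negP=> /ai; rewrite /ord_ltn ltnn.
rewrite /inversions eq_card0 ?scale1r // => -[k l]; rewrite !inE /=.
apply/negP=> /andP[/andP[/eqP-> /ai]]; rewrite /ord_ltn => h1 h2.
by move: h1; rewrite ltnNge ltnW.
Qed.

Lemma anticommuting_gen : anticommuting (@ext_gen K n).
Proof. by split=> [i|i j]; [apply: ext_gen_sqr | apply: ext_gen_anticomm]. Qed.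

Definition lin_form a j : E := \sum_i a i j *: ext_gen K i.

Lemma lin_form_mul a b i j : lin_form a i * lin_form b j =
  \sum_k \sum_l (a k i * b l j) *: (ext_gen K k * ext_gen K l).
Proof.
rewrite mulr_suml; apply: eq_bigr => k _; rewrite mulr_sumr; apply: eq_bigr => l _.
by rewrite -scalerAl -scalerAr scalerA.
Qed.

Hypothesis charK0 : [pchar K] =i pred0.

Lemma anticommuting_lin_form a : anticommuting (lin_form a).
Proof.
have ac i j : lin_form a j * lin_form a i = - (lin_form a i * lin_form a j).
  rewrite !lin_form_mul exchange_big -sumrN; apply: eq_bigr => k _ /=.
  rewrite -sumrN; apply: eq_bigr => l _.
  by rewrite ext_gen_anticomm scalerN mulrC.
(* Anticommuting with itself, a form has twice its square equal to 0. *)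
split=> // i; have /eqP := ac i i; rewrite -subr_eq0 opprK -mulr2n -scaler_nat.
rewrite scaler_eq0; move/pcharf0P: charK0 => ->; by move/eqP.
Qed.

Lemma ext_act_linear a : linear (ext_act a).
Proof.
move=> c f g; rewrite /ext_act scaler_sumr -big_split; apply: eq_bigr => S _ /=.
by rewrite scalerA -scalerDl !ffunE.
Qed.

HB.instance Definition _ a := GRing.isLinear.Build K E E _ (ext_act a) (ext_act_linear a).

Lemma ext_act_mono a S : ext_act a (ext_mono K S) = \prod_(j <- enum S) lin_form a j.
Proof.
rewrite /ext_act (bigD1 S) //= ffunE eqxx scale1r [X in _ + X]big1 ?addr0 // => T TS.
by rewrite ffunE (negbTE TS) scale0r.
Qed.

Lemma ext_actM a f g : ext_act a (f * g) = ext_act a f * ext_act a g.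
Proof.
have mm S T : ext_act a (ext_mono K S * ext_mono K T) =
    ext_act a (ext_mono K S) * ext_act a (ext_mono K T).
  have [c [U eqx]] := sort_word (enum S ++ enum T).
  have := eqx _ anticommuting_gen; rewrite big_cat /= !prod_ext_gen => ->.
  have := eqx _ (anticommuting_lin_form a); rewrite big_cat /= -!ext_act_mono => ->.
  by rewrite linearZ.
rewrite (ext_monoE f) (ext_monoE g) mulr_suml !linear_sum /= mulr_suml.
apply: eq_bigr => S _; rewrite !mulr_sumr !linear_sum /=; apply: eq_bigr => T _.
by rewrite -!scalerAl -!scalerAr !linearZ /= mm -!scalerAl -!scalerAr.
Qed.

Lemma ext_act1 a : ext_act a 1 = 1.
Proof. by rewrite [LHS]ext_act_mono enum_set0 big_nil. Qed.

Lemma ext_act_gen a i : ext_act a (ext_gen K i) = lin_form a i.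
Proof. by rewrite ext_act_mono enum_set1 big_seq1. Qed.

Lemma ext_act_comp a b f : ext_act a (ext_act b f) = ext_act (a *m b) f.
Proof.
have lf j : ext_act a (lin_form b j) = lin_form (a *m b) j.
  rewrite linear_sum /= /lin_form.
  under eq_bigr => i _ do rewrite linearZ /= ext_act_gen scaler_sumr.
  rewrite exchange_big; apply: eq_bigr => k _ /=; rewrite mxE scaler_suml.
  by apply: eq_bigr => i _; rewrite scalerA mulrC.
rewrite [in ext_act b f]/ext_act linear_sum /=; apply: eq_bigr => S _.
rewrite linearZ /=; congr (_ *: _).
have prodE s : ext_act a (\prod_(j <- s) lin_form b j) = \prod_(j <- s) lin_form (a *m b) j.
  by elim: s => [|j s IH]; rewrite ?big_nil ?ext_act1 // !big_cons ext_actM IH lf.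
exact: prodE.
Qed.

Lemma ext_act_id f : ext_act 1%:M f = f.
Proof.
rewrite [RHS]ext_monoE; apply: eq_bigr => S _; rewrite -prod_ext_gen; congr (_ *: _).
apply: eq_bigr => j _; rewrite (bigD1 j) //= mxE eqxx scale1r big1 ?addr0 // => i ij.
by rewrite mxE (negbTE ij) scale0r.
Qed.

Lemma ext_mul_neq0 f g U : (f * g) U != 0 ->
  exists S T, [/\ f S != 0, g T != 0, [disjoint S & T] & U = S :|: T].
Proof.
have [/existsP[S /existsP[T /and4P[fS gT ST /eqP eU]]] _|none] :=
  boolP [exists S, exists T, [&& f S != 0, g T != 0, [disjoint S & T] & U == S :|: T]].
  by exists S, T.
case/eqP; rewrite [f * g]/(ext_mul f g) /ext_mul sum_ffunE big1 // => S _.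
rewrite sum_ffunE big1 // => T _; rewrite !ffunE /ext_sign.
move: none; rewrite negb_exists => /forallP/(_ S); rewrite negb_exists => /forallP/(_ T).
case: (eqVneq (f S) 0) => [->|_]; first by rewrite !mul0r scale0r.
case: (eqVneq (g T) 0) => [->|_]; first by rewrite mulr0 mul0r scale0r.
case: ifP => [_|_ _]; last by rewrite mulr0 scale0r.
by case: eqP => //= _ _; rewrite scaler0.
Qed.

Definition of_degree d f : Prop := forall S, f S != 0 -> #|S| = d.

Lemma of_degree_mul d d' f g : of_degree d f -> of_degree d' g -> of_degree (d + d') (f * g).
Proof.
move=> hf hg U /ext_mul_neq0[S [T [/hf <- /hg <- dST ->]]].
by rewrite cardsU -setI_eq0 in dST *; rewrite (eqP dST) cards0 subn0.
Qed.

Lemma ext_monoEn S T : (ext_mono K S) T = (T == S)%:R.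
Proof. by rewrite ffunE. Qed.

Lemma of_degree_mono S : of_degree #|S| (ext_mono K S).
Proof. by move=> T; rewrite ext_monoEn; case: (T =P S) => [->//|_]; rewrite eqxx. Qed.

Lemma of_degree_lin_form a j : of_degree 1 (lin_form a j).
Proof.
move=> S; rewrite sum_ffunE; apply: contraNeq => S1; rewrite big1 // => i _.
rewrite ffunE; suff -> : ext_gen K i S = 0 by rewrite scaler0.
rewrite ext_monoEn; case: eqP => // eS; by rewrite eS cards1 in S1.
Qed.

Lemma of_degree_word a s : of_degree (size s) (\prod_(j <- s) lin_form a j).
Proof.
elim: s => [|j s IH].
  by rewrite big_nil => S; have := @of_degree_mono set0 S; rewrite cards0.
rewrite big_cons /= -add1n; apply: of_degree_mul IH; apply: of_degree_lin_form.
Qed.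

Lemma ext_act_coef a f T :
  ext_act a f T = \sum_(S : {set 'I_n} | #|S| == #|T|) f S * ext_act a (ext_mono K S) T.
Proof.
rewrite [in LHS]/ext_act sum_ffunE [RHS]big_mkcond; apply: eq_bigr => S _.
rewrite ffunE ext_act_mono /GRing.scale /=; case: eqP => // ST.
case: (eqVneq ((\prod_(j <- enum S) lin_form a j) T) 0) => [->|nz]; first exact: mulr0.
by case: ST; rewrite (of_degree_word nz) cardE.
Qed.

Lemma set2_card (i j : 'I_n) : (i < j)%N -> #|[set i; j]| = 2.
Proof. by move=> ij; rewrite cards2 neq_ltn ij. Qed.

Lemma ext_act_coef2 a p q (x y : 'I_n) : (p < q)%N -> (x < y)%N ->
  ext_act a (ext_mono K [set p; q]) [set x; y] = minor2 a x y p q.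
Proof.
move=> pq xy; rewrite -ext_gen_mul // ext_actM !ext_act_gen lin_form_mul.
have gg (i j : 'I_n) : (ext_gen K i * ext_gen K j : E) [set x; y] =
    ((i == x) && (j == y))%:R - ((i == y) && (j == x))%:R.
  wlog ij : i j / (i < j)%N => [W|].
    case: (ltngtP i j) => [/W//|/W ji|/val_inj->].
      by rewrite ext_gen_anticomm ffunE ji opprB andbC [X in _ - (nat_of_bool X)%:R = _]andbC.
    by rewrite ext_gen_sqr ffunE [(j == y) && _]andbC subrr.
  rewrite ext_gen_mul // ext_monoEn eq_set2 ![_ == i]eq_sym ![_ == j]eq_sym.
  have F : (i == y) && (j == x) = false.
    by apply/negP=> /andP[/eqP ei /eqP ej]; move: ij xy; rewrite ei ej; lia.
  by rewrite [(j == x) && _]andbC F orbF subr0.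
rewrite sum_ffunE.
under eq_bigr => i _.
  rewrite sum_ffunE; under eq_bigr => j _ do rewrite ffunE gg /GRing.scale /= mulrBr.
  rewrite big_split /= sumrN; over.
rewrite big_split /= sumrN /minor2; congr (_ - _).
  rewrite (bigD1 x) //= (bigD1 y) //= !eqxx mulr1 !big1 ?addr0 // => [i ix|j jy].
    by rewrite big1 // => j _; rewrite (negbTE ix) mulr0.
  by rewrite (negbTE jy) andbF mulr0.
rewrite (bigD1 y) //= (bigD1 x) //= !eqxx mulr1 !big1 ?addr0 // => [|i ix|j jy].
- exact: mulrC.
- by rewrite big1 // => j _; rewrite (negbTE ix) mulr0.
- by rewrite (negbTE jy) andbF mulr0.
Qed.

Lemma sum_set2 (F : {set 'I_n} -> K) :
  \sum_(S : {set 'I_n} | #|S| == 2) F S =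
  \sum_(z : 'I_n * 'I_n | (z.1 < z.2)%N) F [set z.1; z.2].
Proof.
rewrite -[RHS]big_set /= -(big_imset F (h := fun z : 'I_n * 'I_n => [set z.1; z.2])) /=.
  apply: eq_bigl => S; apply/idP/imsetP => [/cards2P[x [y [xy ->]]]|[z]]; last first.
    by rewrite inE => /set2_card + ->; move=> ->.
  move: xy; rewrite neq_ltn => /orP[xy|yx]; [exists (x, y)|exists (y, x)]; rewrite ?inE //.
  by rewrite setUC.
move=> [c d] [c' d']; rewrite !inE /= => cd cd' /eqP.
rewrite eq_set2 => /orP[]/andP[/eqP ea /eqP eb]; first by rewrite ea eb.
by move: cd cd'; rewrite ea eb; lia.
Qed.

Lemma ext_act_edge_coef a f (x y : 'I_n) : (x < y)%N ->
  ext_act a f [set x; y] =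
  \sum_(z : 'I_n * 'I_n | (z.1 < z.2)%N) f [set z.1; z.2] * minor2 a x y z.1 z.2.
Proof.
move=> xy; rewrite ext_act_coef set2_card // sum_set2; apply: eq_bigr => z z12.
by rewrite ext_act_coef2.
Qed.

End Words.

(** * The generic initial ideal *)

Section MonomialIdeal.
Variables (K : fieldType) (n : nat).
Notation E := (exterior K n).
Implicit Types (i j : 'I_n) (S T : {set 'I_n}) (f g h : E) (D G : {set {set 'I_n}}).

(** The monomials of J_D; sets with at most one element are faces even at isolated vertices. *)
Definition nonface D S : bool := (2 < #|S|)%N || (#|S| == 2) && (S \notin D).

Definition nonface_ideal D f : Prop := forall S, f S != 0 -> nonface D S.

Lemma nonface_mono D S : nonface D S -> nonface_ideal D (ext_mono K S).
Proof. by move=> nS T; rewrite ext_monoEn; case: (T =P S) => [->//|_]; rewrite eqxx. Qed.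

Lemma nonfaceU D S T : [disjoint S & T] -> nonface D S -> nonface D (S :|: T).
Proof.
move=> dST; rewrite /nonface cardsU -setI_eq0 in dST *.
rewrite (eqP dST) cards0 subn0 => /orP[S2|/andP[S2 SD]].
  by rewrite (leq_trans S2) // leq_addr.
case: (set_0Vmem T) => [->|[x xT]]; first by rewrite cards0 addn0 setU0 S2 SD orbT.
have : (0 < #|T|)%N by rewrite card_gt0; apply/set0Pn; exists x.
by rewrite (eqP S2) => T0; apply/orP; left; rewrite -[X in (X < _)%N]addn0 ltn_add2l.
Qed.

Lemma nonface_is_ideal D : is_ideal (nonface_ideal D).
Proof.
split.
- by move=> S; rewrite ffunE eqxx.
- move=> f g If Ig S; rewrite ffunE; case: (eqVneq (f S) 0) => [->|/If//].
  by rewrite add0r; apply: Ig.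
- move=> f g Ig; split=> U /ext_mul_neq0[S [T [fS gT dST ->]]].
    by rewrite setUC; apply: nonfaceU; [rewrite disjoint_sym | apply: Ig].
  by apply: nonfaceU => //; apply: Ig.
Qed.

Lemma sub_nonface_ideal D (I : E -> Prop) : is_ideal I ->
  (forall i j, (i < j)%N -> [set i; j] \notin D -> I (ext_mono K [set i; j])) ->
  (forall S, #|S| = 3 -> I (ext_mono K S)) ->
  forall f, nonface_ideal D f -> I f.
Proof.
move=> [I0 ID IM] I2 I3 f If.
have IZ c g : I g -> I (c *: g).
  by move=> Ig; rewrite -[g]mul1r scalerAl; case: (IM (c *: 1) g Ig).
have I2' S : #|S| == 2 -> S \notin D -> I (ext_mono K S).
  case/cards2P=> x [y [xy ->]]; move: xy; rewrite neq_ltn => /orP[xy|yx]; first exact: I2.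
  by rewrite setUC; apply: I2.
(* A larger monomial is, up to sign, a multiple of the one on three of its variables; multiplying by
   the sign again removes it. *)
have I3' S : (2 < #|S|)%N -> I (ext_mono K S).
  move=> S3; pose T := [set x in take 3 (enum S)].
  have uT : uniq (take 3 (enum S)) by rewrite take_uniq ?enum_uniq.
  have TS : T \subset S.
    by apply/subsetP=> x; rewrite inE => /mem_take; rewrite mem_enum.
  have cT : #|T| = 3.
    have -> : #|T| = #|take 3 (enum S)| by apply: eq_card => x; rewrite inE.
    by rewrite (card_uniqP uT) size_takel // -cardE.
  have [+ _] := IM (ext_mono K (S :\: T)) _ (I3 T cT).
  have dST : [disjoint S :\: T & T].
    by rewrite -setI_eq0 setIDAC setDIl setDv setI0.
  have eST : (S :\: T) :|: T = S.
    by apply/setP=> x; rewrite 2!inE; case xT: (x \in T); rewrite ?orbF //= (subsetP TS x xT).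
  have -> : ext_mono K (S :\: T) * ext_mono K T = ext_sign K (S :\: T) T *: ext_mono K S.
    by rewrite [LHS]ext_mul_mono eST.
  rewrite /ext_sign dST => /(IZ ((-1) ^+ inversions (S :\: T) T)).
  by rewrite scalerA -exprD addnn -mul2n exprM sqrrN expr1n expr1n scale1r.
rewrite (ext_monoE f); have Isum : forall s : seq {set 'I_n}, I (\sum_(S <- s) f S *: ext_mono K S).
  elim=> [|S s IH]; first by rewrite big_nil.
  rewrite big_cons; apply: ID => //; case: (eqVneq (f S) 0) => [->|nz].
    by rewrite scale0r.
  by apply: IZ; case/orP: (If S nz) => [|/andP[]]; [apply: I3' | apply: I2'].
exact: Isum.
Qed.

Lemma face_idealE G f : face_ideal (K := K) G f <-> nonface_ideal G f.
Proof.
split=> [|If I II gens].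
  apply; first exact: nonface_is_ideal.
  move=> g [[i [j [ij ijG ->]]]|[S S3 ->]]; last first.
    by apply: nonface_mono; rewrite /nonface S3.
  wlog lt : i j ij ijG / (i < j)%N => [W|].
    move: (ij); rewrite neq_ltn => /orP[lt|lt]; first exact: W.
    rewrite ext_gen_anticomm => S; rewrite ffunE oppr_eq0; move: S.
    by apply: W; rewrite // 1?eq_sym // setUC.
  by rewrite ext_gen_mul //; apply: nonface_mono; rewrite /nonface cards2 ij ijG.
apply: (sub_nonface_ideal II) If => [i j ij ijG|S S3]; apply: gens; last by right; exists S.
by left; exists i, j; rewrite ext_gen_mul // neq_ltn ij.
Qed.

(** On pairs the order compares rows before positions within a row, so leading terms can be
    controlled row by row. *)
Lemma revlex_lt2 (x y p q : 'I_n) : (x < y)%N -> (p < q)%N ->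
  revlex_lt [set x; y] [set p; q] = (x < p)%N || (x == p) && (y < q)%N.
Proof.
move=> xy pq; rewrite /revlex_lt !set2_card // ltnn eqxx /=; apply/existsP/orP; last first.
  case=> [xp|/andP[/eqP exp yq]].
    exists x; apply/and3P; split; rewrite ?inE ?eqxx // -?val_eqE /=; first lia.
    by apply/forallP=> j; apply/implyP=> jx; apply/eqP; rewrite !inE -!val_eqE /=; lia.
  rewrite exp in xy *; exists y; apply/and3P; split; rewrite ?inE ?eqxx ?orbT // -?val_eqE /=; first lia.
  by apply/forallP=> j; apply/implyP=> jy; apply/eqP; rewrite !inE -!val_eqE /=; lia.
case=> i /and3P[]; rewrite !inE => ixy ipq /forallP agr.
have ag j : (j < i)%N -> (j == x) || (j == y) = (j == p) || (j == q).
  by move=> ji; move: (agr j); rewrite ji !inE => /eqP.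
have := ag p; have := ag x; have := ag q; rewrite !eqxx /= ?orbT.
move: ixy ipq; rewrite -!val_eqE /=; lia.
Qed.

End MonomialIdeal.

(** * The initial ideal for a generic substitution *)

Section GinChordal.
Variables (K : fieldType) (n : nat) (G : {set {set 'I_n}}) (r : nat -> nat) (a : 'M[K]_n).
Let D := rows_graph n 0 r.
Hypothesis charK0 : [pchar K] =i pred0.
Hypotheses (simpleG : simple_graph G) (chordalG : chordal_rows G setT r).
Hypotheses (cardGD : #|G| = #|D|) (ua : a \in unitmx).
Let b := invmx a.
Hypothesis genb : generic_mx G D b.
Notation E := (exterior K n).
Implicit Types (p q x y : 'I_n) (f h : E).

Lemma ext_actVK f : ext_act b (ext_act a f) = f.
Proof. by rewrite ext_act_comp // mulVmx // ext_act_id. Qed.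

Lemma ext_actKV f : ext_act a (ext_act b f) = f.
Proof. by rewrite ext_act_comp // mulmxV // ext_act_id. Qed.

Lemma in_pairs_rows p q : ((p, q) \in pairs D) = (p < q <= p + r p)%N.
Proof.
by rewrite inE /=; case pq: (p < q)%N => //=; rewrite adj_rows_graph // subn0.
Qed.

(** The minor matrix is square because |G| = |D|; row [l] of [Q] is the functional dual to the
    [l]-th product. *)
Lemma dual_basis : exists Q : 'M[K]_(#|pairs D|, #|pairs G|),
  Q *m minor_mx b G (pairs D) = 1%:M /\ minor_mx b G (pairs D) *m Q = 1%:M.
Proof.
have /row_fullP[Q QM] := genb.1.
have /row_freeP[B MB] := minor_mx_free simpleG cardGD genb.
exists Q; split=> //; suff -> : Q = B by [].
by rewrite -[Q]mulmx1 -MB mulmxA QM mul1mx.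
Qed.

Lemma pairing_dual Q (l m : 'I_#|pairs D|) : Q *m minor_mx b G (pairs D) = 1%:M ->
  pairing b (row l Q) (enum_val m).1 (enum_val m).2 = (l == m)%:R.
Proof.
by move=> QM; rewrite -minor_mxE -row_mul QM !mxE.
Qed.

(* A dual vector vanishes on the edges of [D] in the rows before its own, hence
   on everything in these rows. *)
Lemma pairing_dual_row Q (l : 'I_#|pairs D|) p q : Q *m minor_mx b G (pairs D) = 1%:M ->
  (p < (enum_val l).1)%N -> pairing b (row l Q) p q = 0.
Proof.
move=> QM pl; pose k : 'I_n.+1 := widen_ord (leqnSn n) (enum_val l).1.
apply: (pairing_rows_eq0 simpleG chordalG cardGD genb (k := k)) => //.
move=> c cD ck; have := pairing_dual l (enum_rank_in cD c) QM.
rewrite enum_rankK_in // => ->; case: eqP => // el.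
by move: ck; rewrite /k /= el enum_rankK_in // ltnn.
Qed.

Lemma set2_ordered (S : {set 'I_n}) : #|S| == 2 -> exists p q, (p < q)%N /\ S = [set p; q].
Proof.
case/cards2P=> p [q [pq ->]]; move: pq; rewrite neq_ltn => /orP[pq|qp].
  by exists p, q.
by exists q, p; rewrite setUC.
Qed.

(** Suppose the leading pair pq were in [D], and apply its dual functional, which kills [f] because
    [h] vanishes on [G]. A smaller pair is either in an earlier row, where the functional vanishes
    altogether, or in row p before q, hence another edge of [D]; so only the leading coefficient
    remains, and it would be 0. *)
Lemma initial_nonface f h S : nonface_ideal G h -> f = ext_act a h ->
  is_initial f S -> nonface D S.
Proof.
move=> Gh ef [fS ltS].
have [S2|S2|/eqP S2] := ltngtP #|S| 2.
- case/eqP: fS; rewrite ef ext_act_coef big1 // => T /eqP TS.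
  case: (eqVneq (h T) 0) => [->|/Gh]; first by rewrite mul0r.
  by rewrite /nonface TS => /orP[|/andP[/eqP]]; lia.
- by rewrite /nonface S2.
rewrite /nonface S2 /=; apply/orP; right; apply/negP=> SD.
have [p [q [pq eS]]] := set2_ordered S2.
have pqD : (p, q) \in pairs D by rewrite inE /= pq /adj -eS.
have [Q [QM _]] := dual_basis.
set l := enum_rank_in pqD (p, q); have el : enum_val l = (p, q) by rewrite enum_rankK_in.
have hE k : h [set (@enum_val _ (mem (pairs G)) k).1; (enum_val k).2] = 0 :> K.
  have := enum_valP k; case: (enum_val k) => x y; rewrite inE /= => /andP[xy xyG].
  by apply/eqP/negPn/negP => /Gh; rewrite /nonface set2_card // -/(adj G x y) xyG.
have hk k : h [set (@enum_val _ (mem (pairs G)) k).1; (enum_val k).2] =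
    \sum_(z : 'I_n * 'I_n | (z.1 < z.2)%N) f [set z.1; z.2] *
      minor2 b (enum_val k).1 (enum_val k).2 z.1 z.2.
  rewrite -[h]ext_actVK -ef; have := enum_valP k; rewrite inE => /andP[lt _].
  exact: ext_act_edge_coef.
have : \sum_(z : 'I_n * 'I_n | (z.1 < z.2)%N) f [set z.1; z.2] * pairing b (row l Q) z.1 z.2 = 0.
  under eq_bigr => z _ do rewrite mulr_sumr.
  rewrite exchange_big big1 //= => k _.
  under eq_bigr => z _ do rewrite mulrCA.
  by rewrite -mulr_sumr -hk hE mulr0.
rewrite (bigD1 (p, q)) //= -eS.
have -> : pairing b (row l Q) p q = 1.
  by have := pairing_dual l l QM; rewrite el eqxx.
rewrite mulr1 big1 ?addr0 => [/eqP|[x y] /= /andP[xy nz]]; first by rewrite (negbTE fS).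
case: (eqVneq (f [set x; y]) 0) => [->|fxy]; first by rewrite mul0r.
have nS : [set x; y] != S.
  rewrite eS eq_set2; apply: contra nz => /orP[/andP[/eqP-> /eqP->]//|/andP[/eqP ex /eqP ey]].
  by move: xy pq; rewrite ex ey; lia.
have := ltS _ fxy nS; rewrite eS revlex_lt2 // => lt.
suff -> : pairing b (row l Q) x y = 0 by rewrite mulr0.
case: (ltnP x p) lt => [xp _|px /andP[/eqP exp yq]].
  by apply: pairing_dual_row QM _; rewrite el.
have xyD : (x, y) \in pairs D.
  have := pqD; rewrite !in_pairs_rows => /andP[_ qr]; rewrite xy exp /=.
  by apply: leq_trans qr; apply: ltnW.
have := pairing_dual l (enum_rank_in xyD (x, y)) QM; rewrite enum_rankK_in //= => ->.
case: eqP => // e; move: nz; have := congr1 (@enum_val _ (mem (pairs D))) e.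
by rewrite el enum_rankK_in // => ->; rewrite eqxx.
Qed.

(** Expand f_p f_q modulo J_G in the basis indexed by [D]; the coordinates [c l] are the values of
    the dual functionals. They vanish for rows after p, and row p of [D] ends before q, so the pair
    pq leads in the resulting element. *)
Lemma nonface_initial p q : (p < q)%N -> [set p; q] \notin D ->
  exists f, ext_image a (nonface_ideal G) f /\ is_initial f [set p; q].
Proof.
move=> pq pqD; have [Q [QM MQ]] := dual_basis.
pose c l := pairing b (row l Q) p q.
pose e l : E := ext_mono K [set (@enum_val _ (mem (pairs D)) l).1; (enum_val l).2].
pose f : E := ext_mono K [set p; q] - \sum_l c l *: e l.
have fE T : f T = (T == [set p; q])%:R - \sum_l c l * (T == [set (@enum_val _ (mem (pairs D)) l).1; (enum_val l).2])%:R.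
  rewrite /f [LHS]ffunE ext_monoEn [X in _ + X]ffunE sum_ffunE; congr (_ - _).
  by apply: eq_bigr => l _; rewrite ffunE ext_monoEn.
have f2 T : f T != 0 -> #|T| = 2.
  rewrite fE; apply: contraNeq => T2.
  have T_neq x y : (x < y)%N -> (T == [set x; y]) = false.
    by move=> xy; apply/eqP=> eT; rewrite eT set2_card in T2.
  rewrite T_neq // big1 ?subr0 // => l _; rewrite T_neq ?mulr0 //.
  by have := enum_valP l; rewrite inE => /andP[].
exists f; split.
  exists (ext_act b f); last by rewrite ext_actKV.
  move=> T nz; have T2 : #|T| = 2.
    apply/eqP; move: nz; rewrite ext_act_coef; apply: contraNT => T2.
    rewrite big1 // => S /eqP ST; case: (eqVneq (f S) 0) => [->|/f2]; first by rewrite mul0r.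
    by rewrite ST => /eqP; rewrite (negbTE T2).
  rewrite /nonface T2 /=; apply: contraNN nz => TG.
  have [x [y [xy eT]]] := set2_ordered (introT eqP T2).
  have xyG : (x, y) \in pairs G by rewrite inE /= xy /adj -eT.
  set k := enum_rank_in xyG (x, y); have ek : enum_val k = (x, y) by rewrite enum_rankK_in.
  have ef : ext_act b f = ext_act b (ext_mono K [set p; q]) - \sum_l c l *: ext_act b (e l).
    rewrite /f linearB; congr (_ - _); rewrite [LHS]linear_sum.
    by apply: eq_bigr => l _; rewrite linearZ.
  rewrite ef eT [X in X == _]ffunE ext_act_coef2 // [X in _ + X]ffunE sum_ffunE.
  pose m : 'cV[K]_#|pairs G| := \col_j minor2 b (enum_val j).1 (enum_val j).2 p q.
  have cE l : c l = (Q *m m) l 0.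
    by rewrite /c /pairing mxE; apply: eq_bigr => j _; rewrite !mxE.
  have : (minor_mx b G (pairs D) *m (Q *m m)) k 0 = m k 0 by rewrite mulmxA MQ mul1mx.
  rewrite mxE [m k 0]mxE ek /= => em; rewrite subr_eq0; apply/eqP; apply: etrans (esym em) _; apply: eq_bigr => l _.
  rewrite [RHS]ffunE /GRing.scale /= cE mulrC !mxE ek /=; congr (_ * _).
  have := enum_valP l; rewrite inE => /andP[lt _].
  by rewrite ext_act_coef2.
split.
  rewrite fE eqxx big1 ?subr0 ?oner_eq0 // => l _.
  have := enum_valP l; rewrite inE => /andP[_ lD].
  by case: eqP => [el|]; [rewrite el -/(adj _ _ _) lD in pqD | rewrite mulr0].
move=> T fT Tpq.
have [l cl eT] : exists2 l, c l != 0 & T = [set (@enum_val _ (mem (pairs D)) l).1; (enum_val l).2].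
  have [/existsP[l /andP[cl /eqP eT]]|none] := boolP [exists l, (c l != 0) &&
      (T == [set (@enum_val _ (mem (pairs D)) l).1; (enum_val l).2])]; first by exists l.
  case/eqP: fT; rewrite fE (negbTE Tpq) big1 ?subr0 // => l _.
  move: none; rewrite negb_exists => /forallP/(_ l).
  by case: (eqVneq (c l) 0) => [->|_ /= /negbTE->]; rewrite ?mul0r ?mulr0.
have := enum_valP l; move: cl eT; rewrite /c; have := @pairing_dual_row Q l p q QM.
case: (enum_val l) => x y /= row0 cl -> xyD; have := xyD; rewrite inE /= => /andP[xy _].
rewrite revlex_lt2 //; case: (ltngtP x p) => //= [px|/val_inj exp].
  by rewrite row0 // eqxx in cl.
rewrite exp eqxx /=; move: xyD; rewrite in_pairs_rows exp => /andP[_ yp].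
rewrite ltnNge; apply: contra pqD => qy.
by rewrite -/(adj D p q) adj_rows_graph //= subn0; apply: leq_trans qy yp.
Qed.

Lemma initial_idealE f : initial_ideal (ext_image a (face_ideal G)) f <-> nonface_ideal D f.
Proof.
split=> [|Df I II gens].
  apply; first exact: nonface_is_ideal.
  move=> _ [g [S [[h /face_idealE Gh eg] inS ->]]].
  by apply: nonface_mono; apply: initial_nonface Gh eg inS.
apply: (sub_nonface_ideal II) Df => [p q pq pqD|S S3]; apply: gens.
  have [g [[h Gh eg] ing]] := nonface_initial pq pqD.
  by exists g, [set p; q]; split=> //; exists h => //; apply/face_idealE.
(* A cubic monomial is its own leading term, and it is in the image ideal because substitution by
   [b] preserves degree. *)
exists (ext_mono K S), S; split=> //; last first.
  split; first by rewrite ext_monoEn eqxx oner_eq0.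
  by move=> T; rewrite ext_monoEn; case: (T =P S) => // _; rewrite eqxx.
exists (ext_act b (ext_mono K S)); last by rewrite ext_actKV.
apply/face_idealE => T; rewrite ext_act_coef => nz.
suff ST : #|S| = #|T| by rewrite /nonface -ST S3.
apply/eqP; apply: contraNT nz => ST; rewrite big1 // => U /eqP UT.
rewrite ext_monoEn; case: (U =P S) => [eU|]; last by rewrite mul0r.
by rewrite -UT eU eqxx in ST.
Qed.

End GinChordal.

(** The shifts enter twice: they give |G| = |D|, and they carry the identity minors of [D] back to a
    minor matrix of full rank for [G]. *)
Lemma exterior_shifted_rows (K : fieldType) (n : nat) (G : {set {set 'I_n}}) r s :
  [pchar K] =i pred0 -> simple_graph G -> chordal_rows G setT r ->
  all (fun p : 'I_n * 'I_n => p.1 < p.2)%N s -> shifts s G = rows_graph n 0 r ->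
  exterior_shifted K G (rows_graph n 0 r).
Proof.
move=> charK0 sG cG als es; set D := rows_graph n 0 r in es *.
split; first exact: simple_rows_graph.
have cardGD : #|G| = #|D| by rewrite -es card_shifts.
have [b1 full1] : exists b : 'M[K]_n, row_full (minor_mx b G (pairs D)).
  apply: (@minor_mx_shifts K n charK0 1%:M s G (pairs D) sG als).
  by rewrite es; apply: minor_mx1.
exists (nonface_ideal D).
  have [U [openU exU genU]] := zariski_generic charK0 full1.
  exists U; split=> // a /genU[ua ga] f; exact: initial_idealE.
move=> i j ij; wlog lt : i j ij / (i < j)%N => [W|].
  move: (ij); rewrite neq_ltn => /orP[lt|lt]; first exact: W.
  have ji : j != i by rewrite eq_sym.
  rewrite setUC ext_gen_anticomm; apply: (iff_trans (W j i ji lt)).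
  have IN : forall f : exterior K n, nonface_ideal D f -> nonface_ideal D (- f).
    by move=> f If S; rewrite ffunE oppr_eq0; apply: If.
  by split=> nI If; apply: nI; [rewrite -[X in nonface_ideal D X]opprK|]; apply: IN.
rewrite ext_gen_mul //; split=> [ijD /(_ [set i; j])|nI].
  by rewrite ext_monoEn eqxx oner_eq0 /nonface set2_card // ijD => /(_ isT).
by apply: contraT => ijD; case: nI; apply: nonface_mono; rewrite /nonface set2_card.
Qed.

Theorem theorem4p9 (K : fieldType) (charK0 : [pchar K] =i pred0) (n : nat)
    (G D : {set {set 'I_n}}) (simpleG : simple_graph G) (chordalG : chordal G)
    (returnsD : alg_returns G D) :
  exterior_shifted K G D /\ exists2 Dc, combinatorial_shifted G Dc & D = Dc.
Proof.
have [r [s [cr eD als es shD]]] := alg_returns_chordal simpleG chordalG returnsD.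
split; last by exists D => //; split=> //; exists s.
by rewrite eD; apply: exterior_shifted_rows als _; rewrite // -es.
Qed.
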